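(* Let $k$ be a positive integer and let $a_k$ be the number of limiting vacillating tableaux of length $2k$. Then $$a_k=\sum_{j=1}^{k}\left(\genfrac\{\}{0pt}{}{k}{j}\sum_{\lambda\vdash j}f^\lambda\right),$$ where $\genfrac\{\}{0pt}{}{k}{j}$ is the Stirling number of the second kind (the number of set partitions of $[k]$ into $j$ blocks), the inner sum is over integer partitions $\lambda$ of $j$, and $f^\lambda$ is the number of standard Young tableaux of shape $\lambda$.
   Context: Notation: $[n]=\{1,2,\dots,n\}$. Integer partitions are identified with their Young diagrams (English notation, rows left-justified, row $j$ having $\lambda_j$ boxes, rows numbered from the top). A partial tableau is a filling of the boxes of an integer partition (its shape) with distinct positive integers increasing along rows (left to right) and down columns; a standard Young tableau with $j$ boxes is a partial tableau whose set of entries is exactly $[j]$. RSK row insertion $x\xrightarrow{RSK}T$, for a partial tableau $T$ and a positive integer $x$ not in $T$: let $R$ be the first row of $T$. While $x$ is less than some element of $R$: let $y$ be the smallest element of $R$ greater than $x$; replace $y$ in $R$ by $x$; set $x:=y$ and let $R$ be the next row. When $x$ is not less than any element of $R$, place $x$ at the end of $R$ (which is possibly empty). The result is a partial tableau. Jeu de taquin deletion $x\xleftarrow{jdt}T$, for a partial tableau $T$ and an entry $x$ of $T$: let $c$ be the box containing $x$, at position $(i,j)$ (row $i$, column $j$). While the position $(i,j)$ of $x$ is not a corner (a box that is both at the end of its row and at the end of its column), exchange $x$ with the smaller of the entries at positions $(i+1,j)$ and $(i,j+1)$ (if only one of these exists, exchange with that one), and update $(i,j)$ to be the new position of $x$.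 When $x$ is in a corner, delete that box. The result is a partial tableau. The vacillating tableau $P^k_m(\boldsymbol{i})$, for $\boldsymbol{i}=(i_1,\dots,i_k)\in[m]^k$: let $T^{(0)}$ be the tableau of one row of shape $(m)$ with entries $1,2,\dots,m$. For integers $j=0,1,\dots,k-1$ put $T^{(j+\frac12)}=\left(i_{j+1}\xleftarrow{jdt}T^{(j)}\right)$ and $T^{(j+1)}=\left(i_{j+1}\xrightarrow{RSK}T^{(j+\frac12)}\right)$. Let $\lambda^{(j)}$ be the shape of $T^{(j)}$ for every index $j\in\{0,\frac12,1,1\frac12,\dots,k\}$. Then $P^k_m(\boldsymbol{i})=(\lambda^{(0)},\lambda^{(\frac12)},\lambda^{(1)},\dots,\lambda^{(k-\frac12)},\lambda^{(k)})$. Simplified version: for an integer partition $\lambda=(\lambda_1,\lambda_2,\dots,\lambda_t)$, let $\lambda^*=(\lambda_2,\dots,\lambda_t)$ be obtained by removing the first part. For a sequence $P=(\lambda^{(j)}: j=0,\frac12,1,\dots,k)$ of partitions, $P^*=((\lambda^{(j)})^*: j=0,\frac12,1,\dots,k)$. Limiting vacillating tableau: for $\boldsymbol{i}\in[n]^k$, the sequence $(P^k_m(\boldsymbol{i}))^*$ is the same for all $m>n+2k$; this common value is denoted $P^*(\boldsymbol{i})$ and called the limiting vacillating tableau of $\boldsymbol{i}$. The limiting vacillating tableaux of length $2k$ are the distinct sequences $P^*(\boldsymbol{i})$ as $\boldsymbol{i}$ ranges over all sequences of $k$ positive integers. *)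

(* Defs.v *)
(* all_boot comes last: classical_sets also defines [partition], and the one used
   below is that of finset. *)
From mathcomp Require Import boolp classical_sets functions cardinality.
From mathcomp Require Import all_boot.

Set Implicit Arguments.
Unset Strict Implicit.
Unset Printing Implicit Defensive.

(* An integer partition is the weakly decreasing sequence of its (positive)
   parts; the empty sequence is the partition of 0. *)
Definition is_partition (la : seq nat) : bool :=
  sorted geq la && (0 \notin la).

(* A filling is the sequence of its rows from top to bottom.  Rows and columns
   are numbered from 0. *)
Definition filling := seq (seq nat).

Definition shape (T : filling) : seq nat := map size T.

Definition entry (T : filling) (r c : nat) : nat := nth 0 (nth [::] T r) c.

Definition is_box (T : filling) (r c : nat) : bool := c < size (nth [::] T r).

Definition column_increasing (R S : seq nat) : bool :=
  all (fun c => nth 0 R c < nth 0 S c) (iota 0 (size S)).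

Definition is_partial_tableau (T : filling) : bool :=
  [&& is_partition (shape T), uniq (flatten T), 0 \notin flatten T,
      all (sorted ltn) T & sorted column_increasing T].

Definition is_standard_tableau (T : filling) : bool :=
  is_partial_tableau T &&
  perm_eq (flatten T) (iota 1 (sumn (shape T))).

(* Only used on nonempty sequences. *)
Definition smallest (s : seq nat) : nat := foldr minn (head 0 s) s.

Fixpoint rsk_insert (x : nat) (T : filling) : filling :=
  match T with
  | [::] => [:: [:: x]]
  | R :: T' =>
      let larger := [seq z <- R | x < z] in
      if larger is [::] then rcons R x :: T'
      else let y := smallest larger in
           set_nth 0 R (index y R) x :: rsk_insert y T'
  end.

Definition set_entry (T : filling) (r c v : nat) : filling :=
  set_nth [::] T r (set_nth 0 (nth [::] T r) c v).

Definition exchange (T : filling) (r c r' c' : nat) : filling :=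
  set_entry (set_entry T r c (entry T r' c')) r' c' (entry T r c).

(* One pass of the jeu de taquin loop for the entry at position (r, c); a state
   in which (r, c) is a corner is left unchanged. *)
Definition jdt_step (s : filling * (nat * nat)) : filling * (nat * nat) :=
  let: (T, (r, c)) := s in
  let down := (exchange T r c r.+1 c, (r.+1, c)) in
  let right := (exchange T r c r c.+1, (r, c.+1)) in
  match is_box T r.+1 c, is_box T r c.+1 with
  | false, false => s
  | true, false => down
  | false, true => right
  | true, true => if entry T r.+1 c < entry T r c.+1 then down else right
  end.

(* c is the last column of row r; a row that becomes empty disappears. *)
Definition delete_corner (T : filling) (r c : nat) : filling :=
  [seq R <- set_nth [::] T r (take c (nth [::] T r)) | R != [::]].

(* A slide path visits each box at most once, so after as many passes as there
   are boxes the loop has reached a corner. *)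
Definition jdt_delete (x : nat) (T : filling) : filling :=
  let r := find (fun R => x \in R) T in
  let c := index x (nth [::] T r) in
  let: (T', (r', c')) := iter (sumn (shape T)) jdt_step (T, (r, c)) in
  delete_corner T' r' c'.

Fixpoint vacillating_from (T : filling) (i : seq nat) : seq (seq nat) :=
  match i with
  | [::] => [:: shape T]
  | x :: i' =>
      let T' := jdt_delete x T in
      shape T :: shape T' :: vacillating_from (rsk_insert x T') i'
  end.

Definition vacillating (m : nat) (i : seq nat) : seq (seq nat) :=
  vacillating_from [:: iota 1 m] i.

Definition simplified (P : seq (seq nat)) : seq (seq nat) := map behead P.

(* P is the value common to the simplified vacillating tableaux of i for all
   m > n + 2k, for every n such that i belongs to [n]^k. *)
Definition is_limiting_of (k : nat) (i : k.-tuple nat) (P : seq (seq nat)) :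
    Prop :=
  forall n m : nat,
    all (fun x => 0 < x <= n) i -> n + 2 * k < m ->
    simplified (vacillating m i) = P.

Definition limiting_vacillating_tableaux (k : nat) : set (seq (seq nat)) :=
  [set P | exists i : k.-tuple nat,
      all (fun x => 0 < x) i /\ is_limiting_of i P]%classic.

Definition stirling2 (k j : nat) : nat :=
  #|[set P : {set {set 'I_k}} | partition P [set: 'I_k] & #|P| == j]%SET|.

(* A partition of j has at most j parts, each at most j, so it is the sequence
   of values of a unique element of the following finite type. *)
Definition bounded_seq (j : nat) : finType := {bseq j of 'I_j.+1}.

Definition seq_of_bounded (j : nat) (s : bounded_seq j) : seq nat :=
  [seq val x | x <- s].

Definition partitions_of (j : nat) : {set bounded_seq j} :=
  [set la | is_partition (seq_of_bounded la) & sumn (seq_of_bounded la) == j]%SET.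

(* Likewise, a standard tableau with j boxes has at most j rows, each with at
   most j entries, and these entries are at most j. *)
Definition num_standard_tableaux (la : seq nat) : nat :=
  let j := sumn la in
  #|[set T : {bseq j of bounded_seq j} |
      is_standard_tableau [seq seq_of_bounded R | R <- T] &
      shape [seq seq_of_bounded R | R <- T] == la]%SET|.

(* Main.v *)
Require Import Defs.
From mathcomp Require Import boolp classical_sets functions cardinality.
From mathcomp Require Import all_boot.
From mathcomp Require Import zify.
(* Imported again so that [shape] and [smallest] are those of fillings. *)
Import Defs.

Set Implicit Arguments.
Unset Strict Implicit.
Unset Printing Implicit Defensive.

(** Let [i] have entries at most n and let m > n + 2k.  In every tableau that
    arises, the first row still ends with entries larger than n, so that an inserted
    entry always bumps there.  Below the first row, each step therefore removes at
    most one box and then adds exactly one: the limiting vacillating tableaux are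
    remove-add paths from the empty partition ([word_trace_path],
    [enough_zeros_bump]).  Conversely, row insertion and jeu de taquin deletion can
    both be undone, given the box that they add or remove.  Starting from any tableau
    of the final shape with a long first row, a remove-add path can be run backwards
    to an initial row, which reads off a sequence [i] that produces the path
    ([remove_add_path_realized]).  So the limiting vacillating tableaux are exactly
    the remove-add paths of k steps ([limiting_vacillating_tableauxE]).

    Both operations are handled by their growth rules.  A tableau is encoded by the
    list of its entries in decreasing order, each with its row; the rules say how the
    row of each entry changes and which box has been added or removed so far.  They are
    local, hence easy to invert ([word_insert_inv], [word_delete_inv]), and agreement
    with the algorithms on fillings is an induction on the largest entry
    ([rsk_insert_tab], [jdt_delete_tab]).

    The paths are counted with the operators U and D that sum a function of
    partitions over the upper and lower neighbours.  The number of paths of k steps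
    from the empty partition is the value there of (U + DU)^k applied to the
    constant 1.  From UD = DU + 1 ([up_sum_down_sum]) follows
    U^j (U + DU) = U^(j+1) + j U^j + D U^(j+1), and the last term vanishes at the
    empty partition.  This is the recurrence of the Stirling numbers, so that the
    count is the sum over j of S(k, j) times the value of U^j applied to 1
    ([step_iterE]).  That value is the number of chains of j additions from the empty
    partition, that is, of standard tableaux with j boxes
    ([sum_num_standard_tableaux]). *)

(** * Adding and removing a box of a partition *)
Definition addable (la : seq nat) (r : nat) : bool :=
  (r == 0) || (nth 0 la r < nth 0 la r.-1).

Definition removable (la : seq nat) (r : nat) : bool :=
  nth 0 la r.+1 < nth 0 la r.

(** A part that becomes zero is dropped; in a partition only the last part can,
    so [take] removes nothing else. *)
Definition decr_nth (la : seq nat) (r : nat) : seq nat :=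
  if nth 0 la r == 1 then take r la else set_nth 0 la r (nth 0 la r).-1.

Lemma addableS la r : addable la r.+1 = removable la r.
Proof. by []. Qed.

Lemma partition_leq la r : is_partition la -> nth 0 la r.+1 <= nth 0 la r.
Proof.
case/andP=> /(sortedP 0) srt _; case: (ltnP r.+1 (size la)) => [/srt //|le].
by rewrite nth_default.
Qed.

Lemma partition_gt0 la r : is_partition la -> (0 < nth 0 la r) = (r < size la).
Proof.
case/andP=> _ nz; case: (ltnP r (size la)) => [lt|ge]; last by rewrite nth_default.
by rewrite lt0n; apply: contra nz => /eqP <-; rewrite mem_nth.
Qed.

Lemma partitionI la :
  (forall r, nth 0 la r.+1 <= nth 0 la r) ->
  (forall r, r < size la -> 0 < nth 0 la r) -> is_partition la.
Proof.
move=> le gt; apply/andP; split; first by apply/(sortedP 0)=> i _; exact: le.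
by apply/negP=> /(nthP 0) [i /gt + e]; rewrite e.
Qed.

Lemma partition_ext la mu : is_partition la -> is_partition mu ->
  nth 0 la =1 nth 0 mu -> la = mu.
Proof.
move=> pla pmu e; apply: (@eq_from_nth _ 0) => [|i _]; last exact: e.
have lt i : (i < size la) = (i < size mu) by rewrite -!partition_gt0 // e.
by have := lt (size la); have := lt (size mu); rewrite !ltnn; lia.
Qed.

Lemma addable_size la r : is_partition la -> addable la r -> r <= size la.
Proof.
move=> pla; rewrite /addable; case: r => //= r lt.
by rewrite -partition_gt0 //; lia.
Qed.

Lemma removable_size la r : removable la r -> r < size la.
Proof.
by rewrite /removable; case: (ltnP r (size la)) => // ge; rewrite !nth_default // leqW.
Qed.

Lemma partition_incr la r :
  is_partition la -> addable la r -> is_partition (incr_nth la r).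
Proof.
move=> pla ar; apply: partitionI => i.
  rewrite !nth_incr_nth; have := partition_leq i pla.
  case: (eqVneq r i.+1) ar => [->|_ _]; last by lia.
  by rewrite /addable /=; lia.
rewrite size_incr_nth nth_incr_nth; have := addable_size pla ar.
have := partition_gt0 i pla.
by case: (ltnP r (size la)); case: (eqVneq r i); lia.
Qed.

Lemma nth_decr la r i : is_partition la -> removable la r ->
  nth 0 (decr_nth la r) i = nth 0 la i - (i == r).
Proof.
move=> pla rr; rewrite /decr_nth; case: eqP => [e1|_].
  have sz : size la = r.+1.
    apply/eqP; rewrite eqn_leq removable_size // andbT leqNgt -partition_gt0 //.
    by move: rr; rewrite /removable; lia.
  case: (ltngtP i r) => [lt|gt|->]; first by rewrite nth_take // subn0.
    by rewrite !nth_default ?size_take ?sz ?ltnSn // ltnW.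
  by rewrite e1 nth_default // size_take sz ltnSn.
rewrite nth_set_nth /=; case: eqP => [->|_]; lia.
Qed.

Lemma decr_partition la r :
  is_partition la -> removable la r -> is_partition (decr_nth la r).
Proof.
move=> pla rr; apply: partitionI => i.
  rewrite !nth_decr //; have := partition_leq i pla.
  by move: rr; rewrite /removable; case: (eqVneq i r) => [->|]; lia.
rewrite nth_decr //; have := removable_size rr; rewrite /decr_nth => ltr.
case: eqP => [e1|n1]; first by rewrite size_take ltr; have := partition_gt0 i pla; lia.
by rewrite size_set_nth; have := partition_gt0 i pla; case: eqP => [->|]; lia.
Qed.

Lemma incr_decr la r :
  is_partition la -> removable la r -> incr_nth (decr_nth la r) r = la.
Proof.
move=> pla rr; have ar : addable (decr_nth la r) r.
  rewrite /addable; case: r rr => //= r rr; rewrite !nth_decr //.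
  by have := partition_leq r pla; move: rr; rewrite /removable; lia.
apply: partition_ext => // [|i]; first exact/partition_incr/ar/decr_partition.
rewrite nth_incr_nth nth_decr //; move: rr; rewrite /removable.
by case: (eqVneq i r) => [->|]; lia.
Qed.

Lemma addable_decr la r : is_partition la -> removable la r ->
  addable (decr_nth la r) r.
Proof.
rewrite /addable; case: r => //= r pla rr; rewrite !nth_decr //.
by have := partition_leq r pla; move: rr; rewrite /removable; lia.
Qed.

Lemma removable_incr la r : is_partition la -> addable la r -> removable (incr_nth la r) r.
Proof.
by move=> pla ar; rewrite /removable !nth_incr_nth; have := partition_leq r pla; lia.
Qed.

Lemma decr_incr la r :
  is_partition la -> addable la r -> decr_nth (incr_nth la r) r = la.
Proof.
move=> pla ar; have p' := partition_incr pla ar; have r' := removable_incr pla ar.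
apply: partition_ext => // [|i]; first exact: decr_partition.
by rewrite nth_decr // nth_incr_nth eq_sym; lia.
Qed.

(** * Commutation of adding and removing boxes *)
(** Sums over the partitions above and below [la] in Young's lattice.  As
    operators on functions of partitions they are adjoint to the usual up and
    down operators on formal sums of partitions. *)
Definition up_sum (h : seq nat -> nat) (la : seq nat) : nat :=
  \sum_(0 <= r < (size la).+1 | addable la r) h (incr_nth la r).

Definition down_sum (h : seq nat -> nat) (la : seq nat) : nat :=
  \sum_(0 <= r < size la | removable la r) h (decr_nth la r).

Lemma eq_up_sum h h' la : is_partition la ->
  (forall mu, is_partition mu -> h mu = h' mu) -> up_sum h la = up_sum h' la.
Proof. by move=> pla e; apply: eq_bigr => r ar; apply: e; exact: partition_incr. Qed.

Lemma up_sumE N h la : is_partition la -> size la < N ->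
  up_sum h la = \sum_(0 <= r < N | addable la r) h (incr_nth la r).
Proof.
move=> pla lt; rewrite (big_cat_nat _ (n := (size la).+1)) //= [X in _ + X]big_nat_cond.
rewrite [X in _ + X]big_pred0 ?addn0 // => r; apply/negP => /andP[/andP[lt1 _]].
by move=> /(addable_size pla); lia.
Qed.

Lemma down_sumE N h la : size la <= N ->
  down_sum h la = \sum_(0 <= r < N | removable la r) h (decr_nth la r).
Proof.
move=> lt; rewrite (big_cat_nat _ (n := size la)) //= [X in _ + X]big_nat_cond.
rewrite [X in _ + X]big_pred0 ?addn0 // => r; apply/negP => /andP[/andP[lt1 _]].
by move=> /removable_size; lia.
Qed.

(** Operations on distinct rows are independent: whether they are possible does
    not depend on their order. *)
Lemma addable_removable_swap la r s : is_partition la -> r != s ->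
  addable la r && removable (incr_nth la r) s =
  removable la s && addable (decr_nth la s) r.
Proof.
move=> pla nrs; apply/andP/andP => -[h1 h2].
  have rs : removable la s.
    by move: h2; rewrite /removable !nth_incr_nth; lia.
  split=> //; move: h1 h2; rewrite /addable /removable; case: r nrs => //= r nrs.
  rewrite !nth_decr // !nth_incr_nth; case: (eqVneq r s) => [->|] ; lia.
have ar : addable la r.
  move: h2; rewrite /addable; case: r nrs => //= r nrs; rewrite !nth_decr //; lia.
split=> //; move: (h1) h2; rewrite /addable /removable !nth_incr_nth.
case: r {ar} nrs => [|r] nrs; first by lia.
by rewrite /= !nth_decr //; case: (eqVneq r s) => [->|]; lia.
Qed.

Lemma decr_incrC la r s : is_partition la -> r != s ->
  addable la r -> removable (incr_nth la r) s ->
  decr_nth (incr_nth la r) s = incr_nth (decr_nth la s) r.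
Proof.
move=> pla nrs ar rs; have := addable_removable_swap pla nrs.
rewrite ar rs => /esym /andP[rs' ar'].
have p1 := partition_incr pla ar; have p2 := decr_partition pla rs'.
apply: partition_ext; [exact: decr_partition|exact: partition_incr|move=> i].
by rewrite nth_decr // !nth_incr_nth nth_decr //; lia.
Qed.

(** The commutation relation of Young's lattice.  Moves in different rows
    cancel by [addable_removable_swap].  A move that is undone at once returns to
    [la]; this happens once per addable row on the left and once per removable row
    on the right, and the row below a removable row is addable, so that the top row
    is the one addable row left over. *)
Lemma up_sum_down_sum h la : is_partition la ->
  up_sum (down_sum h) la = down_sum (up_sum h) la + h la.
Proof.
move=> pla; pose N := (size la).+1.
have szi r : addable la r -> size (incr_nth la r) <= N.
  by move/(addable_size pla); rewrite size_incr_nth; case: ifP; rewrite /N; lia.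
have szd r : removable la r -> size (decr_nth la r) < N.
  move=> /removable_size; rewrite /decr_nth; case: eqP => _ lt.
    by rewrite size_take lt /N; lia.
  by rewrite size_set_nth /N; lia.
have upE : up_sum (down_sum h) la = \sum_(0 <= r < N | addable la r)
   (h la + \sum_(0 <= s < N | removable (incr_nth la r) s && (s != r))
     h (incr_nth (decr_nth la s) r)).
  rewrite (@up_sumE N) // [LHS]big_nat_cond [RHS]big_nat_cond.
  apply: eq_bigr => r /andP[rN ar].
  rewrite (@down_sumE N) ?szi // (bigID (fun s => s == r)) /=; congr (_ + _).
    rewrite (eq_bigl (fun s => s == r)) ?big_nat1_eq ?rN ?decr_incr // => s /=.
    by rewrite andbC; case: eqP => // ->; rewrite removable_incr.
  by apply: eq_bigr => s /andP[rs nsr]; rewrite decr_incrC // eq_sym.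
have downE : down_sum (up_sum h) la = \sum_(0 <= s < N | removable la s)
   (h la + \sum_(0 <= r < N | addable (decr_nth la s) r && (r != s))
     h (incr_nth (decr_nth la s) r)).
  rewrite (@down_sumE N) // [LHS]big_nat_cond [RHS]big_nat_cond.
  apply: eq_bigr => s /andP[sN rs].
  rewrite (@up_sumE N) ?szd ?decr_partition // (bigID (fun r => r == s)) /=.
  congr (_ + _).
  rewrite (eq_bigl (fun r => r == s)) ?big_nat1_eq ?sN ?incr_decr // => r /=.
  by rewrite andbC; case: eqP => // ->; rewrite addable_decr.
rewrite upE downE !big_split /= addnAC; congr (_ + _).
  (* Row 0 is always addable, and row r + 1 is addable when row r is removable. *)
  rewrite big_mkcond /= big_nat_recl //= -big_mkcond /= addnC; congr (_ + _).
  rewrite big_mkcond [RHS]big_mkcond /= big_nat_recr //=.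
  by rewrite /removable !nth_default // addn0.
rewrite (exchange_big_dep_nat (fun s => removable la s)) /=; last first.
  move=> r s _ _ ar /andP[rs nsr]; have := @addable_removable_swap la r s pla.
  by rewrite eq_sym nsr ar rs => /(_ isT) /esym /andP[].
rewrite [LHS]big_nat_cond [RHS]big_nat_cond.
apply: eq_bigr => s /andP[_ rs]; apply: eq_bigl => r.
have := @addable_removable_swap la r s pla; rewrite rs (eq_sym s r).
by case: (eqVneq r s) => [_|_ /(_ isT) /= <-]; rewrite ?andbF ?andbT.
Qed.
(** Moving [down_sum] to the left through [up_sum ^ j] by the commutation
    relation. *)
Lemma up_iter_down j h la : is_partition la ->
  iter j up_sum (down_sum h) la =
  down_sum (iter j up_sum h) la + j * iter j.-1 up_sum h la.
Proof.
elim: j la => [|j IH] la pla; first by rewrite addn0.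
rewrite /= (@eq_up_sum _ (fun mu =>
  down_sum (iter j up_sum h) mu + j * iter j.-1 up_sum h mu)) //.
rewrite [LHS]big_split /= -[X in X + _]/(up_sum (down_sum (iter j up_sum h)) la).
rewrite up_sum_down_sum // -addnA mulSn -big_distrr /=; congr (_ + (_ + _)).
by case: j {IH}.
Qed.

(** * Counting remove-add paths *)
(** The sum over the remove-add steps that start at [la]: remove at most one box,
    then add one. *)
Definition step_sum (h : seq nat -> nat) (la : seq nat) : nat :=
  up_sum h la + down_sum (up_sum h) la.

(** At the empty partition every term that begins with [down_sum] vanishes, and
    what remains has the shape of the Stirling recurrence. *)
Lemma up_iter_step j h :
  iter j up_sum (step_sum h) [::] =
  iter j.+1 up_sum h [::] + j * iter j up_sum h [::].
Proof.
have iterD la f g : iter j up_sum (fun mu => f mu + g mu) la =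
    iter j up_sum f la + iter j up_sum g la.
  elim: j la => //= i IH la; rewrite -[RHS]big_split; apply: eq_bigr => r _; exact: IH.
rewrite iterD up_iter_down // iterSr /down_sum big_geq //.
by congr (_ + _); case: j {iterD} => // j; rewrite /= -iterSr.
Qed.

(** * Stirling numbers *)
Definition set_partitions (T : finType) (D : {set T}) (j : nat) : {set {set {set T}}} :=
  [set P | partition P D & #|P| == j].

Section AddPoint.

(* A partition of D with one more point x comes from a partition Q of D and a
   block B of Q that x joins; B = set0 means that x forms a block of its own. *)

Variables (T : finType) (D : {set T}) (x : T).
Hypothesis xD : x \notin D.

Let insert_point (QB : {set {set T}} * {set T}) : {set {set T}} :=
  (x |: QB.2) |: (QB.1 :\ QB.2).

Let choices (j : nat) : {set {set {set T}} * {set T}} :=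
  [set QB | [&& partition QB.1 D, QB.2 \in set0 |: QB.1 & #|QB.1 :\ QB.2| == j]].

Let choicesP j Q B : (Q, B) \in choices j ->
  [/\ partition Q D, B \subset D, partition (Q :\ B) (D :\: B),
      #|Q :\ B| = j & x |: B \notin Q :\ B].
Proof.
rewrite inE /= in_setU1 => /and3P[pQ BQ /eqP cQ].
have sB : B \subset D.
  by case/orP: BQ => [/eqP ->|/(partitionS pQ)]; rewrite ?sub0set.
split => //.
  case/orP: BQ => [/eqP ->|]; last exact: partitionD1.
  rewrite setD0 (_ : Q :\ set0 = Q) //; apply/setP=> C; rewrite !inE.
  by case: eqP => // ->; rewrite (partition0 pQ).
apply/negP => /setD1P[_ /(partitionS pQ) /subsetP /(_ x)].
by rewrite setU11 (negPf xD) => /(_ isT).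
Qed.

Let insert_partition j Q B : (Q, B) \in choices j ->
  partition (insert_point (Q, B)) (x |: D).
Proof.
move=> /choicesP[pQ sB pQB cQ nin].
have -> : x |: D = (x |: B) :|: (D :\: B).
  by rewrite -setUA -{1}(setID D B) (setIidPr sB).
apply: partitionU1 => //; first by apply/set0Pn; exists x; rewrite setU11.
rewrite -setI_eq0; apply/eqP/setP=> y; rewrite !inE.
by case: eqP => [->|_]; rewrite ?(negPf xD) ?andbF //; case: (y \in B).
Qed.

(* The block of x recovers B, which makes insert_point injective. *)
Let blockE j Q B : (Q, B) \in choices j ->
  pblock (insert_point (Q, B)) x = x |: B.
Proof.
move=> QB; apply: def_pblock; rewrite ?setU11 //.
exact: partition_trivIset (insert_partition QB).
Qed.

Lemma card_set_partitions_add_point j :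
  #|set_partitions (x |: D) j.+1| =
  #|set_partitions D j| + j.+1 * #|set_partitions D j.+1|.
Proof.
have -> : set_partitions (x |: D) j.+1 = insert_point @: choices j.
  apply/setP=> P; apply/idP/imsetP => [|[[Q B] QB ->]]; last first.
    have [pQ sB pQB cQ nin] := choicesP QB.
    by rewrite inE (insert_partition QB) /insert_point /= cardsU1 nin cQ eqxx.
  rewrite inE => /andP[pP /eqP cP]; have covP := cover_partition pP.
  have xP : x \in cover P by rewrite covP setU11.
  set A := pblock P x; have AP : A \in P by rewrite pblock_mem.
  have xA : x \in A by rewrite mem_pblock.
  pose B := A :\ x; have AE : x |: B = A by rewrite setD1K.
  have pPA : partition (P :\ A) (D :\: B).
    rewrite (_ : D :\: B = (x |: D) :\: A); first exact: partitionD1.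
    apply/setP=> y; rewrite !inE; case: eqP => [->|_] //=.
    by rewrite (negPf xD) xA.
  have sB : B \subset D.
    apply/subsetP=> y; rewrite in_setD1 => /andP[nyx yA]; have := partitionS pP AP.
    by move/subsetP/(_ y yA); rewrite !inE (negPf nyx).
  have cPA : #|P :\ A| = j by have := cardsD1 A P; rewrite AP cP; case.
  have [B0|B0] := eqVneq B set0.
    exists (P :\ A, set0).
      have nz : (P :\ A) :\ set0 = P :\ A.
        apply/setP=> C; rewrite !inE; case: eqP => // ->.
        by rewrite (partition0 pP) andbF.
      by rewrite !inE /= eqxx /= nz cPA eqxx andbT -[D]setD0 -B0.
    rewrite /insert_point /= -B0 AE -{1}(setD1K AP); congr (_ |: _).
    apply/setP=> C; rewrite !inE; case: (eqVneq C B) => // ->.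
    by rewrite B0 (partition0 pP) andbF.
  have BP : B \notin P :\ A.
    apply: contra B0 => /(partitionS pPA).
    by rewrite subsetD -setI_eq0 setIid => /andP[].
  exists (B |: (P :\ A), B); last by rewrite /insert_point /= setU1K // AE setD1K.
  rewrite !inE /= eqxx orbT setU1K // cPA eqxx andbT.
  have <- : B :|: (D :\: B) = D by rewrite -{1}(setIidPr sB) setID.
  rewrite andbT; apply: partitionU1 => //.
  by rewrite -setI_eq0 setDE setIA setIAC setICr set0I.
rewrite card_in_imset; last first.
  move=> [Q B] [Q' B'] QB QB' e; have := congr1 (fun P => pblock P x) e.
  rewrite /= (blockE QB) (blockE QB').
  have [pQ sB pQB cQ nin] := choicesP QB; have [pQ' sB' _ _ nin'] := choicesP QB'.
  have nx (C : {set T}) : C \subset D -> x \notin C.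
    by move/subsetP/(_ x) => s; apply: contra xD.
  move/(congr1 (fun C => C :\ x)); rewrite !setU1K ?nx // => eB; subst B'.
  move: e; rewrite /insert_point /= => /(congr1 (fun C => C :\ (x |: B))).
  rewrite !setU1K // => e; congr pair; apply/setP => C.
  have [->|nC] := eqVneq C B; last first.
    by have := congr1 (fun X : {set {set T}} => C \in X) e; rewrite /= !inE nC.
  move: QB QB'; rewrite !inE /= => /and3P[_ + _] /and3P[_ + _].
  by case: eqP => [->|_ /= -> ->] //; rewrite (partition0 pQ) (partition0 pQ').
rewrite -sum1_card (eq_bigl (fun QB => partition QB.1 D &&
    ((QB.2 \in set0 |: QB.1) && (#|QB.1 :\ QB.2| == j)))); last first.
  by move=> QB; rewrite inE.
rewrite -(pair_big_dep (fun Q => partition Q D)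
   (fun Q B => (B \in set0 |: Q) && (#|Q :\ B| == j)) (fun _ _ => 1)) /=.
rewrite (eq_bigr (fun Q : {set {set T}} => (#|Q| == j) + j.+1 * (#|Q| == j.+1))) => [|Q pQ].
  rewrite big_split -big_distrr /= -!sum1_card; congr (_ + _ * _).
    by rewrite -big_mkcondr; apply: eq_bigl => Q; rewrite inE.
  by rewrite -big_mkcondr; apply: eq_bigl => Q; rewrite inE.
rewrite big_mkcondr big_setU1 ?(partition0 pQ) //=; congr (_ + _).
  rewrite (_ : Q :\ set0 = Q); first by case: (_ == _).
  by apply/setP=> C; rewrite !inE; case: eqP => // ->; rewrite (partition0 pQ).
rewrite (eq_bigr (fun=> (#|Q| == j.+1) : nat)) => [|B BQ].
  by rewrite sum_nat_const; case: (eqVneq #|Q|) => [->|]; rewrite ?muln0.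
by rewrite (cardsD1 B Q) BQ eqSS; case: (_ == _).
Qed.
End AddPoint.

Fixpoint stirling_number (k j : nat) : nat :=
  match k, j with
  | 0, 0 => 1
  | k'.+1, j'.+1 => stirling_number k' j' + j'.+1 * stirling_number k' j'.+1
  | _, _ => 0
  end.

Lemma card_set_partitions (T : finType) (D : {set T}) j :
  #|set_partitions D j| = stirling_number #|D| j.
Proof.
elim: {D}_.+1 {-2}D (ltnSn #|D|) j => // n IH D; rewrite ltnS => leD j.
have [->|[x xD]] := set_0Vmem D.
  have setE : set_partitions (set0 : {set T}) j = if j == 0 then [set set0] else set0.
    apply/setP=> P; rewrite inE partition_set0.
    by case: j => [|j]; rewrite !inE; case: (P =P set0) => // ->; rewrite cards0.
  by rewrite setE cards0; case: j {setE} => [|j]; rewrite ?cards1 ?cards0.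
have cD := cardsD1 x D; rewrite xD in cD.
rewrite cD add1n -{1}(setD1K xD); case: j => [|j] /=.
  apply: eq_card0 => P; rewrite !inE; apply/negP => /andP[pP]; rewrite cards_eq0 => /eqP P0.
  have := setU11 x (D :\ x); rewrite -(cover_partition pP) P0.
  by rewrite /cover big_set0 inE.
by rewrite card_set_partitions_add_point ?setD11 // !IH //; lia.
Qed.

Lemma stirling2E k j : stirling2 k j = stirling_number k j.
Proof. by have := card_set_partitions [set: 'I_k] j; rewrite cardsT card_ord. Qed.

Lemma stirling_number_gt k j : k < j -> stirling_number k j = 0.
Proof. by elim: k j => [|k IH] [|j] //= lt; rewrite !IH ?muln0 //; lia. Qed.

(** The number of remove-add paths, split by the Stirling recurrence: with
    [h = 1] the left side counts the paths with [k] steps and [iter j up_sum h]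
    the chains with [j] additions. *)
Lemma step_iterE k h :
  iter k step_sum h [::] = \sum_(0 <= j < k.+1) stirling2 k j * iter j up_sum h [::].
Proof.
elim: k h => [|k IH] h; first by rewrite big_nat1 stirling2E mul1n.
rewrite iterSr IH [RHS]big_nat_recl // stirling2E add0n.
under eq_bigr => j _ do rewrite stirling2E up_iter_step mulnDr.
under [RHS]eq_bigr => j _ do rewrite stirling2E /= mulnDl.
rewrite !big_split /=; congr (_ + _).
rewrite big_nat_recl // mul0n muln0 add0n.
rewrite [RHS]big_nat_recr //= stirling_number_gt // muln0 addn0.
by apply: eq_bigr => j _; rewrite mulnCA mulnA.
Qed.
(** * Enumeration of the remove-add paths *)
Definition up_neighbors (la : seq nat) : seq (seq nat) :=
  [seq incr_nth la r | r <- iota 0 (size la).+1 & addable la r].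

Definition down_neighbors (la : seq nat) : seq (seq nat) :=
  [seq decr_nth la r | r <- iota 0 (size la) & removable la r].

Fixpoint remove_add_paths (k : nat) (la : seq nat) : seq (seq (seq nat)) :=
  if k is k'.+1 then
    [seq la :: mu :: p | mu <- la :: down_neighbors la,
                         p <- [seq q | nu <- up_neighbors mu, q <- remove_add_paths k' nu]]
  else [:: [:: la]].

(* Unfolded by hand, since simplification also unfolds the comprehension. *)
Lemma remove_add_pathsS k la : remove_add_paths k.+1 la =
  [seq la :: mu :: p | mu <- la :: down_neighbors la,
     p <- [seq q | nu <- up_neighbors mu, q <- remove_add_paths k nu]].
Proof. by []. Qed.

Lemma up_neighborP la nu : is_partition la ->
  reflect (exists2 r, addable la r & nu = incr_nth la r) (nu \in up_neighbors la).
Proof.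
move=> pla; apply: (iffP mapP) => [[r]|[r ar ->]].
  by rewrite mem_filter => /andP[ar _] ->; exists r.
by exists r => //; rewrite mem_filter ar mem_iota ltnS addable_size.
Qed.

Lemma down_neighborP la mu : is_partition la ->
  reflect (exists r, [/\ is_partition mu, addable mu r & la = incr_nth mu r])
    (mu \in down_neighbors la).
Proof.
move=> pla; apply: (iffP mapP) => [[r]|[r [pmu ar e]]].
  rewrite mem_filter => /andP[rr _] ->; exists r.
  by rewrite decr_partition // addable_decr // incr_decr.
have rr : removable la r by rewrite e removable_incr.
exists r; last by rewrite e decr_incr.
by rewrite mem_filter rr mem_iota removable_size.
Qed.

Lemma remove_add_pathsP k la p : is_partition la ->
  reflect (exists mu nu q, [/\ mu \in la :: down_neighbors la,
             nu \in up_neighbors mu, q \in remove_add_paths k nu & p = la :: mu :: q])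
    (p \in remove_add_paths k.+1 la).
Proof.
move=> pla; apply: (iffP allpairsPdep).
  move=> [mu [q [muin + ->]]].
  by move=> /allpairsPdep[nu [q' [nuin qin ->]]]; exists mu, nu, q'.
move=> [mu [nu [q [muin nuin qin ->]]]].
by exists mu, q; split=> //; apply/allpairsPdep; exists nu, q.
Qed.

Lemma head_remove_add_path k la p : p \in remove_add_paths k la -> head [::] p = la.
Proof.
case: k => [|k]; first by rewrite mem_seq1 => /eqP ->.
by case/allpairsPdep=> mu [q [_ _ ->]].
Qed.

Lemma partition_remove la mu : is_partition la ->
  mu \in la :: down_neighbors la -> is_partition mu.
Proof. by move=> pla /predU1P[->|/(down_neighborP _ pla) [r []]]. Qed.

Lemma partition_up la nu : is_partition la -> nu \in up_neighbors la -> is_partition nu.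
Proof. by move=> pla /(up_neighborP _ pla)[r ar ->]; exact: partition_incr. Qed.

Lemma uniq_indexed_union (I T : eqType) (s : seq I) (t : I -> seq T) (index_of : T -> I) :
  uniq s -> {in s, forall i, uniq (t i)} ->
  (forall i q, i \in s -> q \in t i -> index_of q = i) ->
  uniq [seq q | i <- s, q <- t i].
Proof.
elim: s => //= i s IH /andP[nis us] ut idx; rewrite map_id cat_uniq ut ?mem_head //=.
rewrite IH // => [|j js|j q js]; last 2 first.
- by apply: ut; rewrite inE js orbT.
- by apply: idx; rewrite inE js orbT.
rewrite andbT; apply/hasPn => q /allpairsPdep [j [q' [js qj ->]]].
apply: contra nis => qi; rewrite -(idx i q' (mem_head _ _) qi).
by rewrite (idx j q') // inE js orbT.
Qed.

(** A path begins with its starting shape, so that paths from different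
    neighbours differ. *)
Lemma remove_add_paths_uniq k la : is_partition la -> uniq (remove_add_paths k la).
Proof.
elim: k la => // k IH la pla; rewrite remove_add_pathsS.
apply: allpairs_uniq_dep.
- rewrite cons_uniq; apply/andP; split.
    apply/negP => /(down_neighborP _ pla) [r [_ _ /(congr1 (nth 0 ^~ r))]].
    by rewrite nth_incr_nth eqxx; lia.
  rewrite map_inj_in_uniq ?filter_uniq ?iota_uniq // => r s.
  rewrite !mem_filter => /andP[rr _] /andP[rs _] e; have := incr_decr pla rs.
  by rewrite -e -{2}(incr_decr pla rr) => /incr_nth_inj.
- move=> mu /(partition_remove pla) pmu; apply: uniq_indexed_union.
  + by rewrite map_inj_uniq ?filter_uniq ?iota_uniq // => r s; exact: incr_nth_inj.
  + by move=> nu /(partition_up pmu); exact: IH.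
  by move=> nu q _; exact: head_remove_add_path.
by move=> [mu q] [mu' q'] _ _ /= [-> ->].
Qed.

Lemma size_remove_add_paths k la : is_partition la ->
  size (remove_add_paths k la) = iter k step_sum (fun=> 1) la.
Proof.
have upE f nu : \sum_(ka <- up_neighbors nu) f ka = up_sum f nu.
  by rewrite /up_sum /up_neighbors big_map big_filter /index_iota subn0.
elim: k la => // k IH la pla; rewrite remove_add_pathsS iterS.
have szE mu : is_partition mu ->
    size [seq q | nu <- up_neighbors mu, q <- remove_add_paths k nu] =
    up_sum (iter k step_sum (fun=> 1)) mu.
  move=> pmu; rewrite size_allpairs_dep sumnE big_map -upE.
  by apply: eq_big_seq => nu /(partition_up pmu) /IH.
rewrite size_allpairs_dep /= sumnE big_map szE // /step_sum; congr (_ + _).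
rewrite /down_sum /down_neighbors big_map big_filter /index_iota subn0.
by apply: eq_bigr => r rr; rewrite szE // decr_partition.
Qed.
(** * Tableaux as words *)
Definition add_cell (T : filling) (a v : nat) : filling :=
  set_nth [::] T a (rcons (nth [::] T a) v).

Arguments add_cell : simpl never.

(** A tableau with entries v and rows a, listed from the largest entry down: the
    pairs (v, a).  Restricting a tableau to its small entries is taking a suffix
    of its word, so that inductions on words remove the largest entry. *)
Definition word := seq (nat * nat).

Definition tab (w : word) : filling :=
  foldr (fun l T => add_cell T l.2 l.1) [::] w.

Definition word_shape (w : word) : seq nat :=
  foldr (fun l la => incr_nth la l.2) [::] w.

(** Increasing rows and columns amount to this: each entry exceeds all the
    earlier ones and its box was addable to their shape. *)
Fixpoint tableau_word (w : word) : bool :=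
  if w is (v, a) :: w' then
    [&& all (gtn v) (unzip1 w'), addable (word_shape w') a & tableau_word w']
  else true.

(** The growth rule of row insertion.  The second component is the row of the box
    that insertion adds.  An entry whose box is that new box is bumped into the next
    row; every other entry stays in its row. *)
Fixpoint word_insert (x : nat) (w : word) : word * nat :=
  match w with
  | [::] => ([:: (x, 0)], 0)
  | (v, a) :: w' =>
      if v < x then ((x, 0) :: w, 0) else
      let: (u, b) := word_insert x w' in
      if a == b then ((v, b.+1) :: u, b.+1) else ((v, a) :: u, b)
  end.

(** The growth rule of jeu de taquin.  The second component is the row of the box
    that deletion vacates.  If the next entry v stands just below the vacated box,
    it moves up and the vacated row becomes that of v; this is when v could not
    be placed in its row a over the new shape.  If v stands just to the right of the
    vacated box, it moves left, which changes neither row. *)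
Fixpoint word_delete (x : nat) (w : word) : word * nat :=
  match w with
  | [::] => ([::], 0)
  | (v, a) :: w' =>
      if v == x then (w', a) else
      let: (u, d) := word_delete x w' in
      if (a == d.+1) && (nth 0 (word_shape u) d.+1 == nth 0 (word_shape u) d)
      then ((v, d) :: u, d.+1) else ((v, a) :: u, d)
  end.

Lemma word_shape_partition w : tableau_word w -> is_partition (word_shape w).
Proof.
by elim: w => //= -[v a] w IH /and3P[_ aa /IH pw]; exact: partition_incr.
Qed.

Lemma tableau_word_uniq w : tableau_word w -> uniq (unzip1 w).
Proof.
elim: w => //= -[v a] w IH /and3P[ltv _ /IH ->]; rewrite andbT.
by apply/negP => /(allP ltv) /=; rewrite ltnn.
Qed.

Lemma mem_word_insert x w : unzip1 (word_insert x w).1 =i x :: unzip1 w.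
Proof.
elim: w => //= -[v a] w IH; case: ltnP => // _ y.
case: (word_insert x w) IH => u b /= IH.
have -> : unzip1 (if a == b then ((v, b.+1) :: u, b.+1) else ((v, a) :: u, b)).1
          = v :: unzip1 u by case: eqP.
by rewrite !inE IH !inE orbCA.
Qed.

(** An entry bumped from row b can go to row b + 1, because the box in row b that
    it leaves to the new entry makes that row longer. *)
Lemma word_insert_spec x w :
  tableau_word w -> x \notin unzip1 w ->
  let: (u, b) := word_insert x w in
  [/\ tableau_word u, word_shape u = incr_nth (word_shape w) b &
      addable (word_shape w) b].
Proof.
elim: w => [|[v a] w IH] //=.
rewrite inE negb_or => /and3P[lev aa tw] /andP[nxv nxw].
case: ltnP => [lt|le].
  split; rewrite //= lt aa tw lev /= !andbT.
  by apply/allP=> y /(allP lev) /= ?; lia.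
have ltv : all (gtn v) (unzip1 (word_insert x w).1).
  apply/allP=> y; rewrite mem_word_insert inE => /predU1P[->|/(allP lev)] //=; lia.
have := IH tw nxw; case: (word_insert x w) ltv => u b /= ltv [tu su ab].
have pw := word_shape_partition tw; have le1 := partition_leq b pw.
case: (eqVneq a b) => [->|nab] /=; rewrite ltv tu su /=.
  split=> //; last by rewrite addableS /removable !nth_incr_nth; lia.
  by rewrite andbT addableS /removable !nth_incr_nth; lia.
move: aa ab; rewrite /addable !nth_incr_nth incr_nthC => aa ab; split=> //; lia.
Qed.

Lemma unzip1_word_delete x w : tableau_word w -> unzip1 (word_delete x w).1 = rem x (unzip1 w).
Proof.
elim: w => //= -[v a] w IH /and3P[_ _ /IH]; case: eqP => //= _.
by case: (word_delete x w) => u d /= <-; case: ifP.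
Qed.

(** The shape that results after each entry is again a partition: an entry
    whose box would fail to be addable is exactly one that moves up. *)
Lemma word_delete_spec x w :
  tableau_word w -> x \in unzip1 w ->
  let: (u, d) := word_delete x w in
  [/\ tableau_word u, word_shape w = incr_nth (word_shape u) d &
      addable (word_shape u) d].
Proof.
elim: w => [|[v a] w IH] //=.
rewrite inE eq_sym => /and3P[lev aa tw]; case: eqP => //= _ xw.
have := IH tw xw; have := unzip1_word_delete x tw.
case: (word_delete x w) => u d /= ue [tu su ad].
have ltv : all (gtn v) (unzip1 u).
  by rewrite ue; apply/allP=> y /mem_rem /(allP lev).
have pu := word_shape_partition tu.
case: andP => [[/eqP -> /eqP eqd]|cond] /=; rewrite ltv tu ?ad ?su /=.
  split=> //.
  by rewrite addableS /removable !nth_incr_nth; lia.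
move: aa; rewrite su /addable !nth_incr_nth incr_nthC => aa.
have le1 := partition_leq d pu; move: ad; rewrite /addable => ad.
have -> : (a == 0) || (nth 0 (word_shape u) a < nth 0 (word_shape u) a.-1).
  case: a aa cond => //= a aa cond; apply/negPn/negP => neg; apply: cond.
  have := partition_leq a pu; case: (eqVneq d a) aa => [e|]; last by lia.
  by subst a; lia.
split=> //; case: d ad aa {cond le1 su} => //= d ad aa.
by case: (eqVneq a d.+1) aa => [->|] /=; lia.
Qed.
(** * Row insertion on words *)
Lemma add_cell0 R T v : add_cell (R :: T) 0 v = rcons R v :: T.
Proof. by []. Qed.

Lemma add_cellS R T a v : add_cell (R :: T) a.+1 v = R :: add_cell T a v.
Proof. by []. Qed.

Lemma nth_add_cell T a v r :
  nth [::] (add_cell T a v) r =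
  if r == a then rcons (nth [::] T a) v else nth [::] T r.
Proof. by rewrite nth_set_nth. Qed.

Lemma shape_add_cell T a v : shape (add_cell T a v) = incr_nth (shape T) a.
Proof.
elim: T a => [|R T IH] [|a] //; last by rewrite add_cellS /= IH.
  by rewrite /add_cell /=; elim: a => //= a ->.
by rewrite /= size_rcons.
Qed.

Lemma perm_add_cell T a v :
  perm_eq (flatten (add_cell T a v)) (v :: flatten T).
Proof.
elim: T a => [|R T IH] [|a] //.
- by rewrite /add_cell /= -[ncons a [::] _]/(ncons a [::] [:: [:: v]]); elim: a.
- by rewrite add_cell0 /= cat_rcons perm_catC /= perm_cons perm_catC.
rewrite add_cellS /= (perm_trans (y := R ++ v :: flatten T)) ?perm_cat2l //.
by rewrite perm_catC /= perm_cons perm_catC.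
Qed.

Lemma shape_tab w : shape (tab w) = word_shape w.
Proof. by elim: w => //= l w IH; rewrite shape_add_cell IH. Qed.

Lemma perm_tab w : perm_eq (flatten (tab w)) (unzip1 w).
Proof.
elim: w => //= l w IH; apply: perm_trans (perm_add_cell _ _ _) _.
by rewrite perm_cons.
Qed.

Definition below (v : nat) (T : filling) : bool := all (gtn v) (flatten T).

Lemma below_tab v w : below v (tab w) = all (gtn v) (unzip1 w).
Proof. exact/perm_all/perm_tab. Qed.

Lemma smallest_mem s : s != [::] -> smallest s \in s.
Proof.
case: s => // h s _; rewrite /smallest [head _ _]/=.
have mem t : foldr minn h t \in h :: t.
  elim: t => [|y t IH] /=; first exact: mem_head.
  by rewrite /minn; case: ifP => _; rewrite !inE ?eqxx ?orbT // orbCA -in_cons IH orbT.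
by have := mem (h :: s); rewrite !inE orbA orbb.
Qed.

Lemma smallest_rcons s v : s != [::] -> all (gtn v) s ->
  smallest (rcons s v) = smallest s.
Proof.
case: s => //= h s _ /andP[lt _]; rewrite /smallest /= foldr_rcons.
by rewrite (minn_idPr (ltnW lt)).
Qed.

Lemma set_nth_rcons (T : Type) (x0 : T) s i x v : i < size s ->
  set_nth x0 (rcons s v) i x = rcons (set_nth x0 s i x) v.
Proof. by elim: s i => // y s IH [|i] //= lt; rewrite IH. Qed.

Fixpoint insertion_row (x : nat) (T : filling) : nat :=
  if T is R :: T' then
    let larger := [seq z <- R | x < z] in
    if larger is [::] then 0 else (insertion_row (smallest larger) T').+1
  else 0.

Lemma rsk_insert_max x T : below x T ->
  rsk_insert x T = add_cell T 0 x /\ insertion_row x T = 0.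
Proof.
case: T => //= R T; rewrite /below /= all_cat => /andP[ltR _].
rewrite (_ : [seq z <- R | x < z] = [::]) //.
apply/eqP; rewrite -(negbK (_ == _)) -has_filter -all_predC.
by apply: sub_all ltR => z /= ?; rewrite -leqNgt ltnW.
Qed.

(** The largest entry v does not disturb the insertion of x.  It is bumped if and
    only if its box is the one where the insertion into the smaller tableau ends;
    it then lands at the end of the next row, where no entry exceeds it. *)
Lemma rsk_insert_add_cell x T a v : x < v -> below v T ->
  let b := insertion_row x T in
  rsk_insert x (add_cell T a v) =
    add_cell (rsk_insert x T) (if a == b then b.+1 else a) v /\
  insertion_row x (add_cell T a v) = if a == b then b.+1 else b.
Proof.
elim: T x a => [|R T IH] x [|a] ltx; rewrite /below /= ?all_cat.
- by rewrite /add_cell /= ltx /= /smallest /= minnn eqxx.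
- by rewrite /add_cell /= nth_nil; case: a.
- move=> /andP[ltR ltT]; rewrite filter_rcons ltx.
  set L := filter _ R; have ltL : all (gtn v) L.
    by apply/allP=> z; rewrite mem_filter => /andP[_ /(allP ltR)].
  have [L0|nL0] := eqVneq L [::].
    rewrite L0 /= /smallest /= minnn.
    have [-> ->] := rsk_insert_max ltT.
    rewrite add_cellS (_ : set_nth _ _ _ _ = rcons R x) //.
    have vR : v \notin R by apply/negP => /(allP ltR) /=; rewrite ltnn.
    rewrite -cats1 index_cat (negPf vR) /= eqxx addn0 -cats1.
    by elim: (R) => //= z s ->.
  have yR : smallest L \in R.
    exact: mem_subseq (filter_subseq _ _) _ (smallest_mem nL0).
  rewrite -/L.
  have := smallest_rcons nL0 ltL.
  case: L nL0 ltL yR => // z L _ _ yR /= ->.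
  split=> //; rewrite add_cell0 -[rcons R v]cats1 index_cat yR cats1; congr (_ :: _).
  by rewrite set_nth_rcons ?index_mem.
move=> /andP[ltR ltT].
have ltL : all (gtn v) [seq z <- R | x < z].
  by apply/allP=> z; rewrite mem_filter => /andP[_ /(allP ltR)].
case E: [seq z <- R | x < z] ltL => [|z L] // ltL.
have ltv : smallest (z :: L) < v by apply: (allP ltL); exact: smallest_mem.
by have [-> ->] := IH _ a ltv ltT; rewrite eqSS; case: eqP.
Qed.

Lemma rsk_insert_tab x w : tableau_word w -> x \notin unzip1 w ->
  rsk_insert x (tab w) = tab (word_insert x w).1 /\
  insertion_row x (tab w) = (word_insert x w).2.
Proof.
elim: w => [|[v a] w IH] //=; rewrite inE negb_or => /and3P[ltv _ tw] /andP[nxv nxw].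
case: ltnP => [lt|le].
  apply: rsk_insert_max; have /= -> := below_tab x ((v, a) :: w).
  rewrite lt /=.
  by apply: sub_all ltv => z /= ?; lia.
have ltx : x < v by rewrite ltn_neqAle nxv.
have [e1 e2] := IH tw nxw.
have := @rsk_insert_add_cell x (tab w) a v ltx; rewrite below_tab => /(_ ltv) [-> ->].
rewrite e1 e2; case: (word_insert x w) => u b /=.
by case: eqP.
Qed.
(** * Jeu de taquin on words *)
Lemma nth_shape T r : nth 0 (shape T) r = size (nth [::] T r).
Proof.
case: (ltnP r (size T)) => [lt|ge]; first by rewrite (nth_map [::]).
by rewrite !nth_default ?size_map.
Qed.

Lemma is_box_size T r c : is_box T r c -> r < size T.
Proof. by rewrite /is_box; case: (ltnP r (size T)) => // ge; rewrite nth_default. Qed.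

(** Sizes are compared separately from entries, since [entry] is 0 outside the
    filling. *)
Lemma filling_ext (T T' : filling) : size T = size T' ->
  (forall r, size (nth [::] T r) = size (nth [::] T' r)) ->
  (forall r c, entry T r c = entry T' r c) -> T = T'.
Proof.
move=> sz szr e; apply: (@eq_from_nth _ [::]) => // r _.
by apply: (@eq_from_nth _ 0) => // c _; exact: e.
Qed.

Lemma entry_set_entry T r c v i j :
  entry (set_entry T r c v) i j = if (i == r) && (j == c) then v else entry T i j.
Proof.
rewrite /entry /set_entry nth_set_nth /=.
by case: (eqVneq i r) => //= ->; rewrite nth_set_nth.
Qed.

Lemma size_set_entry T r c v : is_box T r c -> size (set_entry T r c v) = size T.
Proof. by move=> /is_box_size lt; rewrite size_set_nth; apply/maxn_idPr. Qed.

Lemma row_set_entry T r c v i : is_box T r c ->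
  size (nth [::] (set_entry T r c v) i) = size (nth [::] T i).
Proof.
rewrite /is_box => lt; rewrite nth_set_nth /=.
by case: (eqVneq i r) => //= ->; rewrite size_set_nth; apply/maxn_idPr.
Qed.

Lemma is_box_set_entry T r c v i j : is_box T r c ->
  is_box (set_entry T r c v) i j = is_box T i j.
Proof. by move=> b; rewrite /is_box row_set_entry. Qed.

Lemma size_add_cell T a v : size (add_cell T a v) = maxn a.+1 (size T).
Proof. exact: size_set_nth. Qed.

Lemma entry_add_cell T a v i j :
  entry (add_cell T a v) i j =
  if (i == a) && (j == size (nth [::] T a)) then v else entry T i j.
Proof.
rewrite /entry nth_add_cell; case: (eqVneq i a) => //= ->.
rewrite nth_rcons; case: ltngtP => // lt.
by rewrite nth_default // ltnW.
Qed.

Lemma row_add_cell T a v i :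
  size (nth [::] (add_cell T a v) i) = (i == a) + size (nth [::] T i).
Proof. by rewrite nth_add_cell; case: (eqVneq i a) => // ->; rewrite size_rcons. Qed.

Lemma is_box_add_cell T a v i j :
  is_box (add_cell T a v) i j =
  is_box T i j || ((i == a) && (j == size (nth [::] T a))).
Proof.
rewrite /is_box row_add_cell; case: (eqVneq i a) => [->|_] /=; last by rewrite orbF.
by rewrite add1n ltnS leq_eqVlt orbC.
Qed.

Lemma box_neq_new_cell T a i j : is_box T i j ->
  (i == a) && (j == size (nth [::] T a)) = false.
Proof. by move=> b; apply/andP => -[/eqP e /eqP f]; rewrite /is_box e f ltnn in b. Qed.
Lemma exchangeE T r c r' c' i j :
  entry (exchange T r c r' c') i j =
  if (i == r') && (j == c') then entry T r c
  else if (i == r) && (j == c) then entry T r' c' else entry T i j.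
Proof. by rewrite /exchange !entry_set_entry. Qed.

Lemma exchange_add_cell T a v r c r' c' : is_box T r c -> is_box T r' c' ->
  exchange (add_cell T a v) r c r' c' = add_cell (exchange T r c r' c') a v.
Proof.
move=> b b'.
have bT i j : is_box T i j -> is_box (add_cell T a v) i j.
  by rewrite is_box_add_cell => ->.
have b1 : is_box (set_entry T r c (entry T r' c')) r' c' by rewrite is_box_set_entry.
have row1 i : size (nth [::] (exchange T r c r' c') i) = size (nth [::] T i).
  by rewrite /exchange !row_set_entry.
have nocell := @box_neq_new_cell T a.
apply: filling_ext => [|i|i j].
- by rewrite /exchange size_add_cell !size_set_entry ?is_box_set_entry ?bT ?size_add_cell.
- rewrite /exchange !row_set_entry ?is_box_set_entry ?bT // !row_add_cell.
  by rewrite -/(exchange _ _ _ _ _) row1.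
rewrite exchangeE !entry_add_cell exchangeE row1 (nocell _ _ b) (nocell _ _ b').
case: ifP => [/andP[/eqP -> /eqP ->]|_]; first by rewrite nocell.
by case: ifP => [/andP[/eqP -> /eqP ->]|_] //; rewrite nocell.
Qed.

Definition jdt_state := (filling * (nat * nat))%type.

Definition at_corner (s : jdt_state) : bool :=
  let: (T, (r, c)) := s in ~~ is_box T r.+1 c && ~~ is_box T r c.+1.

(** Unlike an iterate of [jdt_step], a path does not stutter at corners.  A corner
    of a tableau may stop being one when the largest entry is added, so that only
    genuine steps lift to the larger tableau. *)
Inductive slide_path : nat -> jdt_state -> jdt_state -> Prop :=
| SlideStop s : slide_path 0 s s
| SlideStep n s s' : ~~ at_corner s -> slide_path n (jdt_step s) s' ->
    slide_path n.+1 s s'.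

Lemma slide_path_trans m n s1 s2 s3 :
  slide_path m s1 s2 -> slide_path n s2 s3 -> slide_path (m + n) s1 s3.
Proof.
elim=> {m s1 s2} [|m s1 s2 nc _ IH] // p; rewrite addSn.
by apply: SlideStep => //; exact: IH.
Qed.

Lemma jdt_step_corner s : at_corner s -> jdt_step s = s.
Proof.
case: s => T [r c] /andP[/negPf b1 /negPf b2]; by rewrite /jdt_step b1 b2.
Qed.

Lemma iter_slide_path n N s s' : slide_path n s s' -> at_corner s' -> n <= N ->
  iter N jdt_step s = s'.
Proof.
move=> p; elim: p N => {n s s'} [s|n s s' _ _ IH] N cs; last first.
  by case: N => // N leN; rewrite iterSr IH.
by move=> _; elim: N => //= N ->; exact: jdt_step_corner.
Qed.

(** Away from a corner the largest entry never wins a comparison, so that adding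
    it leaves the step unchanged. *)
Lemma jdt_step_add_cell T a v r c T' r' c' :
  (forall i j, entry T i j < v) -> is_box T r c -> ~~ at_corner (T, (r, c)) ->
  jdt_step (T, (r, c)) = (T', (r', c')) ->
  [/\ ~~ at_corner (add_cell T a v, (r, c)),
      jdt_step (add_cell T a v, (r, c)) = (add_cell T' a v, (r', c')),
      is_box T' r' c' & forall i j, entry T' i j < v].
Proof.
move=> lev brc nc e.
have nocell := @box_neq_new_cell T a.
have lt_exchange i j k l m n : entry (exchange T i j k l) m n < v.
  by rewrite exchangeE; do 2 case: ifP => _ //.
have bex i j k l : is_box T i j -> is_box T k l -> is_box (exchange T i j k l) k l.
  by move=> b1 b2; rewrite /exchange !is_box_set_entry.
split.
- move: nc; rewrite /at_corner !is_box_add_cell !negb_and !negbK.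
  by move=> /orP[] ->; rewrite ?orbT.
- move: e; rewrite /jdt_step !is_box_add_cell !entry_add_cell.
  move: nc; rewrite /at_corner negb_and !negbK.
  case b1: (is_box T r.+1 c); case b2: (is_box T r c.+1) => //= _;
    rewrite ?(nocell _ _ b1) ?(nocell _ _ b2).
  + by case: ifP => _ [<- <- <-]; rewrite exchange_add_cell.
  + case => <- <- <-; case: ifP => new; last by rewrite exchange_add_cell.
    by rewrite new lev exchange_add_cell.
  case => <- <- <-; case: ifP => new; last by rewrite exchange_add_cell.
  by rewrite new ltnNge ltnW ?lev //= exchange_add_cell.
- move: e nc; rewrite /jdt_step /at_corner negb_and !negbK.
  case b1: (is_box T r.+1 c); case b2: (is_box T r c.+1) => //=.
  + by case: ifP => _ [<- <- <-] _; apply: bex.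
  + by case => <- <- <- _; apply: bex.
  by case => <- <- <- _; apply: bex.
move: e nc; rewrite /jdt_step /at_corner negb_and !negbK => + _.
case: (is_box T r.+1 c); case: (is_box T r c.+1); [case: ifP => _| | |];
  by case => <- _ _.
Qed.

Lemma slide_path_add_cell n T a v p T' p' :
  (forall i j, entry T i j < v) -> is_box T p.1 p.2 ->
  slide_path n (T, p) (T', p') ->
  slide_path n (add_cell T a v, p) (add_cell T' a v, p').
Proof.
elim: n T p => [|n IH] T [r c] lev b path.
  by inversion path; subst; exact: SlideStop.
inversion path as [|m s s' nc path' e1 e2 e3]; subst.
case E: (jdt_step (T, (r, c))) path' => [T1 [r1 c1]] path'.
have [nc' e b1 lev1] := jdt_step_add_cell a lev b nc E.
by apply: SlideStep => //; rewrite e; apply: IH.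
Qed.

Definition position (x : nat) (T : filling) : nat * nat :=
  let r := find (fun R => x \in R) T in (r, index x (nth [::] T r)).

Lemma position_box x T : x \in flatten T -> is_box T (position x T).1 (position x T).2.
Proof.
move=> xT; rewrite /is_box /= index_mem; apply: (@nth_find _ [::] (fun R => x \in R)).
by apply/hasP; case/flattenP: xT => R; exists R.
Qed.

Lemma position_add_cell x v T a : x != v -> x \in flatten T ->
  position x (add_cell T a v) = position x T.
Proof.
move=> nxv xT; have E : find (fun R => x \in R) (add_cell T a v) = find (fun R => x \in R) T.
  elim: T a xT => [|R T IH] [|a] //.
    by rewrite add_cell0 /= mem_rcons inE (negPf nxv).
  rewrite add_cellS /= mem_cat; case: ifP => //= _ xT; by rewrite IH.
rewrite /position E nth_add_cell; congr pair.
have := position_box xT; rewrite /is_box /= index_mem.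
by case: eqP => // -> xr; rewrite -cats1 index_cat xr.
Qed.

Lemma position_new_cell x T a : x \notin flatten T ->
  position x (add_cell T a x) = (a, size (nth [::] T a)).
Proof.
move=> xT; have E : find (fun R => x \in R) (add_cell T a x) = a.
  elim: T a xT => [|R T IH] [|a] //.
  - by rewrite /add_cell /= inE eqxx.
  - by move=> _; rewrite /add_cell /=; elim: a => /= [|a ->]; rewrite ?inE ?eqxx.
  - by rewrite add_cell0 /= mem_rcons inE eqxx.
  by rewrite add_cellS /= mem_cat negb_or => /andP[/negPf -> xT]; rewrite IH.
rewrite /position E nth_add_cell eqxx -cats1 index_cat /= eqxx addn0.
rewrite ifN //; apply: contra xT => xr; apply/flattenP; exists (nth [::] T a) => //.
by apply: mem_nth; case: ltnP xr => // ge; rewrite nth_default.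
Qed.
Lemma add_cellC T a b v x : a != b ->
  add_cell (add_cell T a v) b x = add_cell (add_cell T b x) a v.
Proof.
move=> nab; apply: filling_ext => [|i|i j].
- by rewrite !size_add_cell maxnCA.
- by rewrite !row_add_cell addnCA.
rewrite !entry_add_cell !row_add_cell (eq_sym b) (negPf nab) !add0n.
by case: (eqVneq i a) => [->|_] //; rewrite (negPf nab).
Qed.

Lemma exchange_new_cells T a b v x :
  let c := size (nth [::] T a) in
  let c' := (a == b) + size (nth [::] T b) in
  exchange (add_cell (add_cell T a x) b v) a c b c' =
  add_cell (add_cell T a v) b x.
Proof.
move=> c c'.
have ba : is_box (add_cell (add_cell T a x) b v) a c.
  by rewrite !is_box_add_cell !eqxx orbT.
have bb : is_box (add_cell (add_cell T a x) b v) b c'.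
  by rewrite is_box_add_cell row_add_cell (eq_sym b a) !eqxx orbT.
apply: filling_ext => [|i|i j].
- by rewrite /exchange !size_set_entry ?is_box_set_entry // !size_add_cell.
- by rewrite /exchange !row_set_entry ?is_box_set_entry // !row_add_cell.
have nab : (a == b) && (c == c') = false.
  by rewrite /c /c'; case: (eqVneq a b) => //= ->; rewrite -[X in X == _]add0n eqn_add2r.
rewrite exchangeE !entry_add_cell !row_add_cell (eq_sym b a) -/c -/c' nab !eqxx /=.
by case: (_ && _) => //; case: (_ && _).
Qed.

(** Once x has reached the corner of the smaller tableau, it makes one more step
    exactly when the box of the largest entry v lies just below or just to the
    right of it.  In the latter case v ends where x was, in the same row, so that
    appending v first and x next to it describes the result. *)
Lemma slide_new_cell T d a v x : is_partition (shape T) ->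
  let c := size (nth [::] T d) in
  let down := (a == d.+1) && (size (nth [::] T d.+1) == c) in
  let T' := add_cell T (if down then d else a) v in
  let d' := if down then d.+1 else d in
  exists2 n, n <= 1 &
    slide_path n (add_cell (add_cell T d x) a v, (d, c))
      (add_cell T' d' x, (d', size (nth [::] T' d'))).
Proof.
move=> pT c down T' d'; have le : size (nth [::] T d.+1) <= c.
  by rewrite ?/c -!nth_shape; exact: partition_leq.
have bD : is_box (add_cell (add_cell T d x) a v) d.+1 c = down.
  rewrite !is_box_add_cell /is_box ltnNge le /= (gtn_eqF (ltnSn d)) /=.
  rewrite row_add_cell /down eq_sym; case: (eqVneq a d.+1) => //= ->.
  by rewrite (gtn_eqF (ltnSn d)) eq_sym.
have bR : is_box (add_cell (add_cell T d x) a v) d c.+1 = (a == d).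
  rewrite !is_box_add_cell /is_box -/c ltnNge leqnSn /= eqxx (gtn_eqF (ltnSn c)) /=.
  rewrite row_add_cell (eq_sym d a); case: (eqVneq a d) => [->|//].
  by rewrite add1n eqxx.
rewrite {}/d' {}/T'; case: (boolP down) => dn.
  case/andP: (dn) => /eqP ea /eqP ec; subst a.
  have nR : d.+1 == d = false by rewrite gtn_eqF.
  exists 1 => //; apply: SlideStep; first by rewrite /at_corner bD dn.
  rewrite /jdt_step bD bR nR dn.
  have := exchange_new_cells T d d.+1 v x; rewrite eq_sym nR /= add0n ec => ->.
  by rewrite row_add_cell nR add0n ec; exact: SlideStop.
have [e|nad] := eqVneq a d; last first.
  exists 0 => //; rewrite row_add_cell eq_sym (negPf nad) add0n -/c.
  by rewrite add_cellC 1?eq_sym //; exact: SlideStop.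
subst a; exists 1 => //; apply: SlideStep; first by rewrite /at_corner bR eqxx andbF.
rewrite /jdt_step bD bR eqxx (negPf dn).
have := exchange_new_cells T d d v x; rewrite eqxx add1n -/c /= => ->.
by rewrite row_add_cell eqxx add1n -/c; exact: SlideStop.
Qed.

(** The bound on the length of the path is what makes the fixed number of passes
    of [jdt_delete] sufficient. *)
Lemma slide_tab x w : tableau_word w -> x \in unzip1 w ->
  let: (u, d) := word_delete x w in
  exists2 n, n <= size w &
    slide_path n (tab w, position x (tab w))
      (add_cell (tab u) d x, (d, size (nth [::] (tab u) d))).
Proof.
elim: w => [|[v a] w IH] //=.
rewrite inE eq_sym => /and3P[ltv aa tw].
have nvw : v \notin unzip1 w by apply/negP => /(allP ltv) /=; rewrite ltnn.
case: eqP nvw => [-> nxw _|/eqP nvx nvw /= xw].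
  exists 0 => //; rewrite position_new_cell ?(perm_mem (perm_tab w)) //.
  exact: SlideStop.
have := IH tw xw; have := word_delete_spec tw xw.
case: (word_delete x w) => u d [tu su ad] [n len path].
have lev i j : entry (tab w) i j < v.
  have v0 : 0 < v by have /= := allP ltv x xw; lia.
  rewrite /entry; case: (ltnP j (size (nth [::] (tab w) i))) => [lt|ge].
  2: by rewrite nth_default.
  apply: (allP ltv); rewrite -(perm_mem (perm_tab w)); apply/flattenP.
  exists (nth [::] (tab w) i); last exact: mem_nth.
  by apply: mem_nth; exact: (@is_box_size _ _ j).
have xT : x \in flatten (tab w) by rewrite (perm_mem (perm_tab w)).
have path1 := slide_path_add_cell a lev (position_box xT) path.
have pT : is_partition (shape (tab u)) by rewrite shape_tab; exact: word_shape_partition.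
have [m lem path2] := slide_new_cell d a v x pT.
rewrite position_add_cell 1?[x == v]eq_sym //; move: path2.
rewrite -!nth_shape shape_tab; case: ((a == d.+1) && _) => path2 /=.
  exists (n + m); first by lia.
  by apply: slide_path_trans path1 _; rewrite -!nth_shape shape_tab.
exists (n + m); first by lia.
by apply: slide_path_trans path1 _; rewrite -!nth_shape shape_tab.
Qed.

Lemma delete_new_cell T d x : all (fun R => R != [::]) T -> d <= size T ->
  delete_corner (add_cell T d x) d (size (nth [::] T d)) = T.
Proof.
rewrite /delete_corner nth_add_cell eqxx -cats1 take_size_cat //.
elim: T d => [|R T IH] [|d] //= /andP[nR nT] led; rewrite nR; congr (_ :: _).
  exact/all_filterP.
exact: IH.
Qed.

Lemma delete_corner_tab u d x : tableau_word u -> addable (word_shape u) d ->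
  delete_corner (add_cell (tab u) d x) d (size (nth [::] (tab u) d)) = tab u.
Proof.
move=> tu ad; have pu := word_shape_partition tu.
apply: delete_new_cell; last by rewrite -(size_map size) [map _ _]shape_tab addable_size.
case/andP: pu => _ nz; apply/allP=> R Ru; apply: contra nz => /eqP R0.
by rewrite -shape_tab; apply/mapP; exists R => //; rewrite R0.
Qed.

Lemma jdt_delete_tab x w : tableau_word w -> x \in unzip1 w ->
  jdt_delete x (tab w) = tab (word_delete x w).1.
Proof.
move=> tw xw; have := slide_tab tw xw; have := word_delete_spec tw xw.
case: (word_delete x w) => u d [tu su ad] [n len path] /=.
have le : size (nth [::] (tab u) d.+1) <= size (nth [::] (tab u) d).
  by rewrite -!nth_shape shape_tab; exact/partition_leq/word_shape_partition.
have szw : sumn (shape (tab w)) = size w.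
  by have := perm_size (perm_tab w); rewrite size_flatten size_map.
rewrite /jdt_delete -/(position x (tab w)) (iter_slide_path path); first last.
- by rewrite szw.
- rewrite /at_corner !is_box_add_cell /is_box ltnNge le /= (gtn_eqF (ltnSn d)) /=.
  by rewrite eqxx /= (gtn_eqF (ltnSn _)) orbF ltnNge leqnSn.
exact: delete_corner_tab.
Qed.
(** * Reversibility *)
(** Read from the largest entry, the growth rule can be undone: an entry in the
    last column of the new box's row b was bumped from row b - 1, or is x itself if
    b = 0. *)
Lemma word_insert_inv w b : tableau_word w -> removable (word_shape w) b ->
  exists x u, [/\ tableau_word u, x \notin unzip1 u & word_insert x u = (w, b)].
Proof.
elim: w b => [|[v a] w IH] b /=; first by rewrite /removable !nth_nil.
move=> /and3P[ltv aa tw] rb; have nvw : v \notin unzip1 w.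
  by apply/negP => /(allP ltv) /=; rewrite ltnn.
have pw := word_shape_partition tw.
have old c : removable (word_shape w) c -> exists x u,
    [/\ tableau_word u, x \notin unzip1 u, word_insert x u = (w, c),
        (x < v) && all (gtn v) (unzip1 u) & word_shape w = incr_nth (word_shape u) c].
  move=> /IH -/(_ tw) [x [u [tu xu e]]]; exists x, u.
  have := word_insert_spec tu xu; rewrite e => -[_ sw _].
  split=> //; have ltxu y : y \in x :: unzip1 u -> y < v.
    by rewrite -mem_word_insert e => /(allP ltv).
  by rewrite ltxu ?mem_head //; apply/allP=> y yu; apply: ltxu; rewrite inE yu orbT.
have [eab|nab] := eqVneq a b.
  subst b; case: a aa rb => [|a] aa rb.
    exists v, w; split=> //; case: w {IH tw rb pw old aa nvw} ltv => //= -[v' a'] w /=.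
    by move=> /andP[-> _].
  have [x [u [tu xu e /andP[ltx ltu] su]]] := old a aa.
  exists x, ((v, a) :: u) => /=; rewrite ltu tu e ltnNge ltnW // eqxx andbT.
  rewrite inE negb_or xu ltn_eqF //; split=> //.
  by have := word_insert_spec tu xu; rewrite e => -[].
have rb' : removable (word_shape w) b by move: rb; rewrite /removable !nth_incr_nth; lia.
have [x [u [tu xu e /andP[ltx ltu] su]]] := old b rb'.
exists x, ((v, a) :: u) => /=; rewrite ltu tu e ltnNge ltnW // (negPf nab) andbT.
rewrite inE negb_or xu ltn_eqF //; split=> //.
move: aa rb; rewrite /addable /removable su !nth_incr_nth.
by case: a nab => [|a] nab //=; case: (eqVneq b a) => [->|]; lia.
Qed.

(** Undoing the growth rule: the next entry had moved up, from row e, exactly when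
    row e is not addable before that entry. *)
Lemma word_delete_inv u x e : tableau_word u -> x \notin unzip1 u ->
  addable (word_shape u) e ->
  exists w, [/\ tableau_word w, x \in unzip1 w & word_delete x w = (u, e)].
Proof.
elim: u e => [|[v a] u IH] e /=.
  rewrite /addable !nth_nil orbF => _ _ /eqP ->.
  by exists [:: (x, 0)]; rewrite /= mem_head eqxx.
move=> /and3P[ltv aa tu]; rewrite inE negb_or => /andP[nxv xu] ae.
have pu := word_shape_partition tu.
case: (ltnP v x) => [ltx|lex].
  exists ((x, e) :: (v, a) :: u); rewrite /= ltv aa tu ae ltx mem_head eqxx !andbT.
  by split=> //; apply: sub_all ltv => y /= ?; lia.
have ltx : x < v by rewrite ltn_neqAle nxv.
have old c : addable (word_shape u) c -> exists w,
    [/\ tableau_word w, x \in unzip1 w, word_delete x w = (u, c),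
        all (gtn v) (unzip1 w) & word_shape w = incr_nth (word_shape u) c].
  move=> /IH -/(_ tu xu) [w [tw xw e']]; exists w.
  have := word_delete_spec tw xw; rewrite e' => -[_ sw _]; split=> //.
  apply/allP=> y yw; have [->//|nyx] := eqVneq y x.
  apply: (allP ltv); have := unzip1_word_delete x tw; rewrite e' /= => ->.
  by rewrite mem_rem_uniq ?tableau_word_uniq // inE nyx.
have [ae'|nae] := boolP (addable (word_shape u) e).
  have [w [tw xw e' ltw sw]] := old e ae'.
  exists ((v, a) :: w); rewrite /= ltw tw e' inE xw orbT gtn_eqF //= sw; split=> //.
    rewrite andbT; move: aa ae; rewrite /addable !nth_incr_nth.
    case: a => //= a aa ae; case: (eqVneq a.+1 e) aa ae => [<-|] /=; lia.
  case: eqP => //= ea; subst a; move: aa; rewrite addableS /removable => aa.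
  by rewrite ltn_eqF.
case: e ae nae => // e ae nae.
have ea : a = e by move: ae nae; rewrite /addable /= !nth_incr_nth; lia.
subst a; have [w [tw xw e' ltw sw]] := old e aa.
have eqe : nth 0 (word_shape u) e.+1 = nth 0 (word_shape u) e.
  by have := partition_leq e pu; move: nae; rewrite /addable /=; lia.
exists ((v, e.+1) :: w); rewrite /= ltw tw e' inE xw orbT gtn_eqF //= sw eqe !eqxx.
by split=> //; rewrite andbT addableS /removable !nth_incr_nth; lia.
Qed.
(** * Vacillating tableaux of words *)
Fixpoint word_trace (w : word) (i : seq nat) : seq (seq nat) :=
  if i is x :: i' then
    let u := (word_delete x w).1 in
    word_shape w :: word_shape u :: word_trace (word_insert x u).1 i'
  else [:: word_shape w].

(** Every insertion bumps in the first row, and hence adds its box below it. *)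
Fixpoint always_bumps (w : word) (i : seq nat) : bool :=
  if i is x :: i' then
    let u := (word_delete x w).1 in
    (0 < (word_insert x u).2) && always_bumps (word_insert x u).1 i'
  else true.

Definition row_word (m : nat) : word := [seq (v, 0) | v <- rev (iota 1 m)].

Lemma iota1S m : iota 1 m.+1 = rcons (iota 1 m) m.+1.
Proof. by have := iotaD 1 m 1; rewrite addn1 add1n cats1. Qed.

Lemma row_wordS m : row_word m.+1 = (m.+1, 0) :: row_word m.
Proof. by rewrite /row_word iota1S rev_rcons. Qed.

Lemma unzip1_row_word m : unzip1 (row_word m) = rev (iota 1 m).
Proof. by rewrite /row_word /unzip1 -map_comp map_id. Qed.

Lemma mem_row_word m : unzip1 (row_word m) =i iota 1 m.
Proof. by move=> x; rewrite unzip1_row_word mem_rev. Qed.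

Lemma tableau_row_word m : tableau_word (row_word m).
Proof.
elim: m => // m IH; rewrite row_wordS /= IH andbT.
by apply/allP=> x; rewrite mem_row_word mem_iota /=; lia.
Qed.

Lemma tab_row_word m : 0 < m -> tab (row_word m) = [:: iota 1 m].
Proof.
case: m => // m _; elim: m => // m IH; rewrite row_wordS.
by rewrite iota1S -add_cell0 -IH.
Qed.

Lemma tableau_word_sorted w : tableau_word w -> sorted gtn (unzip1 w).
Proof.
elim: w => //= -[v a] w IH /and3P[ltv _ /IH] /= srt.
by rewrite path_sortedE ?ltv // => x y z /=; lia.
Qed.

Lemma tableau_word_values w n : tableau_word w -> unzip1 w =i iota 1 n ->
  unzip1 w = rev (iota 1 n).
Proof.
move=> tw ew; apply: (irr_sorted_eq (leT := gtn)) => [x y z|x|||x] /=; [lia|lia| | |].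
- exact: tableau_word_sorted.
- by rewrite rev_sorted iota_ltn_sorted.
by rewrite ew mem_rev.
Qed.

Lemma word_step x w : tableau_word w -> x \in unzip1 w ->
  let u := (word_delete x w).1 in
  let w' := (word_insert x u).1 in
  [/\ tableau_word u, x \notin unzip1 u, tableau_word w' & unzip1 w' =i unzip1 w].
Proof.
move=> tw xw u w'; have uw := tableau_word_uniq tw.
have ue : unzip1 u = rem x (unzip1 w) := unzip1_word_delete x tw.
have tu : tableau_word u.
  by have := word_delete_spec tw xw; rewrite /u; case: (word_delete x w) => ? ? [].
have xu : x \notin unzip1 u by rewrite ue mem_rem_uniqF.
split=> //.
  by have := word_insert_spec tu xu; rewrite /w'; case: (word_insert x u) => ? ? [].
move=> y; rewrite mem_word_insert inE ue mem_rem_uniq // inE.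
by case: eqP => // ->; rewrite xw.
Qed.

Lemma vacillating_from_tab w (i : seq nat) : tableau_word w -> {subset i <= unzip1 w} ->
  vacillating_from (tab w) i = word_trace w i.
Proof.
elim: i w => [|x i IH] w tw sub; first by rewrite /= shape_tab.
have xw : x \in unzip1 w by apply: sub; rewrite mem_head.
have [tu xu tw' ew'] := word_step tw xw.
rewrite /= jdt_delete_tab // !shape_tab; have [-> _] := rsk_insert_tab tu xu.
by rewrite IH // => y yi; rewrite ew' sub // inE yi orbT.
Qed.

Lemma behead_incr0 la : behead (incr_nth la 0) = behead la.
Proof. by case: la. Qed.

Lemma behead_incrS la r : behead (incr_nth la r.+1) = incr_nth (behead la) r.
Proof. by case: la => // ; rewrite /=; elim: r. Qed.

Lemma partition_behead la : is_partition la -> is_partition (behead la).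
Proof.
case: la => //= r la /andP[/= srt]; rewrite inE negb_or => /andP[_ nz].
by apply/andP; split=> //; exact: path_sorted srt.
Qed.

Lemma addable_behead la r : addable la r.+1 -> addable (behead la) r.
Proof. by rewrite /addable nth_behead; case: r => //= r; rewrite nth_behead. Qed.

(** Below the first row, deletion removes one box or none, and an insertion that
    bumps adds one. *)
Lemma word_trace_path w (i : seq nat) : tableau_word w -> {subset i <= unzip1 w} ->
  always_bumps w i ->
  map behead (word_trace w i) \in remove_add_paths (size i) (behead (word_shape w)).
Proof.
elim: i w => [|x i IH] w tw sub; first by rewrite mem_seq1.
have xw : x \in unzip1 w by apply: sub; rewrite mem_head.
have [tu xu tw' ew'] := word_step tw xw.
have sub' : {subset i <= unzip1 (word_insert x (word_delete x w).1).1}.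
  by move=> y yi; rewrite ew' sub // inE yi orbT.
rewrite [always_bumps _ _]/= => /andP[b0 good].
have pw := partition_behead (word_shape_partition tw).
have pu := partition_behead (word_shape_partition tu).
have path' := IH _ tw' sub' good.
apply/remove_add_pathsP => //; do 3 eexists; split; last by [].
- rewrite inE; have := word_delete_spec tw xw; move: pu.
  case: (word_delete x w) => u d /= pu [_ -> ad].
  case: d ad => [|d] ad; first by rewrite behead_incr0 eqxx.
  apply/orP; right; rewrite behead_incrS; apply/down_neighborP.
    exact/partition_incr/addable_behead.
  by exists d; rewrite addable_behead.
- 2: exact: path'.
have := word_insert_spec tu xu; move: b0.
case: (word_insert x _) => w' [|b] //= _ [_ -> ab].
apply/up_neighborP => //; exists b; first exact: addable_behead.
by rewrite behead_incrS.
Qed.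

(** A large entry at the end of the first row is never moved, so that it changes
    only the first part of the shapes. *)
Lemma word_trace_cons0 v w (i : seq nat) : all (gtn v) i -> always_bumps w i ->
  always_bumps ((v, 0) :: w) i /\
  map behead (word_trace ((v, 0) :: w) i) = map behead (word_trace w i).
Proof.
elim: i w => [|x i IH] w; first by rewrite /= behead_incr0.
move=> /= /andP[ltx lti]; rewrite gtn_eqF //.
case: (word_delete x w) => u d /=.
have -> : (v < x) = false by apply/negbTE; rewrite -leqNgt ltnW.
case: (word_insert x u) => w' b /= /andP[b0 good]; case: b b0 => // b _.
have [good' e] := IH w' lti good.
by rewrite good' !behead_incr0 e.
Qed.

(** While it is positive, an insertion of x <= n bumps. *)
Definition late_zeros (n : nat) (w : word) : nat :=
  count (fun l => (n < l.1) && (l.2 == 0)) w.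

Lemma late_zeros_delete n x w : x <= n -> late_zeros n w <= late_zeros n (word_delete x w).1.
Proof.
move=> lex; elim: w => //= -[v a] w IH /=; case: (v =P x) => [->|_] /=.
  by rewrite ltnNge lex.
case: (word_delete x w) IH => u d /= IH; case: ifP => [/andP[/eqP -> _]|_] /=.
  by rewrite andbF add0n (leq_trans IH) ?leq_addl.
by rewrite leq_add2l.
Qed.

(** An insertion pushes at most one entry out of the first row. *)
Lemma late_zeros_insert n x w : x <= n -> tableau_word w ->
  let: (u, b) := word_insert x w in
  late_zeros n w <= late_zeros n u + (0 < b) /\ (0 < late_zeros n w -> 0 < b).
Proof.
move=> lex; elim: w => //= -[v a] w IH /and3P[ltv aa tw].
case: ltnP => [lt|le].
  rewrite (_ : late_zeros n w = 0); first by rewrite ltnNge (leq_trans (ltnW lt)).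
  apply/eqP; rewrite -leqn0 leqNgt -has_count; apply/hasPn => -[v' a'] lw /=.
  have /= : v' < v by apply: (allP ltv v'); apply/mapP; exists (v', a').
  by case: ltnP => //; lia.
have := IH tw; case: (word_insert x w) => u b [le1 pos].
case: (eqVneq a b) => [->|nab] /=; last first.
  split; first by lia.
  by case: a nab {aa} => [|a] nab; rewrite ?andbF ?add0n //; lia.
split=> //; case: b le1 pos => [|b] /=; rewrite ?andbF ?andbT; first by case: (n < v); lia.
by lia.
Qed.

Lemma enough_zeros_bump n w (i : seq nat) : tableau_word w -> {subset i <= unzip1 w} ->
  all (geq n) i -> size i <= late_zeros n w -> always_bumps w i.
Proof.
elim: i w => //= x i IH w tw sub /andP[lex lei] ltz.
have xw : x \in unzip1 w by apply: sub; rewrite mem_head.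
have [tu xu tw' ew'] := word_step tw xw.
have lz1 := late_zeros_delete w lex.
have := late_zeros_insert lex tu.
move: tw' ew'; case: (word_insert x _) => w' b /= tw' ew' [lz2 pos].
have b0 : 0 < b by apply: pos; lia.
rewrite b0 IH // => [y yi|]; first by rewrite ew' sub // inE yi orbT.
by move: lz2; rewrite b0; lia.
Qed.

Lemma late_zeros_row_word n m : late_zeros n (row_word m) = m - n.
Proof.
elim: m => // m IH; rewrite row_wordS /= IH andbT; case: ltnP; lia.
Qed.
(** * Every remove-add path is a limiting vacillating tableau *)
Lemma sumn_incr_nth la r : sumn (incr_nth la r) = (sumn la).+1.
Proof.
elim: la r => [|n la IH] [|r] //=; first by elim: r.
by rewrite IH addnS.
Qed.

Lemma sumn_word_shape w : sumn (word_shape w) = size w.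
Proof. by elim: w => //= l w IH; rewrite sumn_incr_nth IH. Qed.

Lemma leq_head_sumn la : nth 0 la 0 <= sumn la.
Proof. by case: la => //= n la; rewrite leq_addr. Qed.

Lemma size_tableau_word w n : tableau_word w -> unzip1 w =i iota 1 n -> size w = n.
Proof.
move=> tw e; rewrite -(size_map fst) -/(unzip1 w) (tableau_word_values tw e).
by rewrite size_rev size_iota.
Qed.

Lemma incr_nth_cancel la mu r : is_partition la -> is_partition mu ->
  incr_nth la r = incr_nth mu r -> la = mu.
Proof.
move=> pla pmu e; apply: partition_ext => // i.
by have := congr1 (nth 0 ^~ i) e; rewrite !nth_incr_nth => /addnI.
Qed.

(** The condition on N leaves room in the first row for every box that is added
    below it. *)
Lemma word_of_shape N mu : is_partition mu -> nth 0 mu 0 < N ->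
  exists w, [/\ tableau_word w, unzip1 w =i iota 1 (N + sumn mu) & word_shape w = N :: mu].
Proof.
elim: {mu}(sumn mu) {-2}mu (erefl (sumn mu)) => [|s IH] mu e pmu lt.
  have -> : mu = [::].
    case: mu e pmu {lt} => //= n mu e /andP[_]; rewrite inE negb_or; lia.
  exists (row_word N); split; rewrite ?tableau_row_word ?e ?addn0 //.
    exact: mem_row_word.
  by case: N lt => // N _; elim: N => // N IHN; rewrite row_wordS /= IHN.
have rr : removable mu (size mu).-1.
  have : 0 < size mu by case: (mu) e.
  by move=> sz; rewrite /removable prednK // nth_default // partition_gt0 // prednK.
set r := (size mu).-1 in rr; have pd := decr_partition pmu rr.
have em := incr_decr pmu rr; have ad := addable_decr pmu rr.
have sd : sumn (decr_nth mu r) = s by move: e; rewrite -em sumn_incr_nth em => -[].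
have [|w [tw ew sw]] := IH _ sd pd; first by rewrite nth_decr //; lia.
exists ((N + sumn mu, r.+1) :: w); split=> /=.
- rewrite tw sw andbT; apply/andP; split.
    by apply/allP=> x; rewrite ew mem_iota sd e /=; lia.
  have lt0 : nth 0 (decr_nth mu r) 0 < N by rewrite nth_decr //; lia.
  by move: ad lt0; rewrite /addable /=; case: (r).
- move=> x; rewrite inE ew e !mem_iota sd; lia.
by rewrite sw /= em.
Qed.

(** The path is run backwards: any tableau of the final shape, uninserted at the
    box that the step adds and undeleted at the box that it removes.  A step that
    removes nothing below the first row undeletes at the end of the first row.
    With 2K + 1 entries, at most K of them below the first row, that row is longer
    than the second one throughout. *)
Lemma remove_add_path_realized K k mu p : is_partition mu -> sumn mu + k <= K ->
  p \in remove_add_paths k mu ->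
  exists w i, [/\ tableau_word w /\ unzip1 w =i iota 1 K.*2.+1,
    behead (word_shape w) = mu, size i = k /\ {subset i <= unzip1 w},
    always_bumps w i & map behead (word_trace w i) = p].
Proof.
elim: k mu p => [|k IH] mu p pmu leK.
  rewrite mem_seq1 => /eqP ->; pose N := K.*2.+1 - sumn mu.
  have := leq_head_sumn mu => lth.
  have [|w [tw ew sw]] := @word_of_shape N mu pmu; first by rewrite /N; lia.
  exists w, [::]; rewrite /= sw; split=> //; split=> // x.
  by rewrite ew (_ : N + sumn mu = K.*2.+1) // /N; lia.
case/remove_add_pathsP=> // nu [ka [q [nuin kain qin ->]]].
have pnu := partition_remove pmu nuin; have pka := partition_up pnu kain.
have /up_neighborP -/(_ pnu) [b ab eka] := kain.
have snu : sumn nu <= sumn mu.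
  move: nuin; rewrite inE => /predU1P[->//|/(down_neighborP _ pmu) [r [_ _ ->]]].
  by rewrite sumn_incr_nth leqnSn.
have ska : sumn ka = (sumn nu).+1 by rewrite eka sumn_incr_nth.
have [|w1 [i [[tw1 ew1] sw1 [szi subi] good tr]]] := IH _ _ pka _ qin; first by lia.
have rb : removable (word_shape w1) b.+1.
  have := removable_incr pnu ab; rewrite -eka -sw1 /removable.
  by rewrite !nth_behead.
have [x [u [tu xu e]]] := word_insert_inv tw1 rb.
have := word_insert_spec tu xu; rewrite e => -[_ sw1u _].
have su : behead (word_shape u) = nu.
  apply: (@incr_nth_cancel _ _ b) => //; first exact/partition_behead/word_shape_partition.
  by rewrite -behead_incrS -sw1u sw1.
have u0 : nth 0 (word_shape u) 0 + sumn nu = K.*2.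
  have := size_tableau_word tw1 ew1; rewrite -sumn_word_shape sw1u sumn_incr_nth -su => -[<-].
  by case: (word_shape u).
have [e0 [ae0 be0]] : exists e0, addable (word_shape u) e0 /\
    behead (incr_nth (word_shape u) e0) = mu.
  move: nuin; rewrite inE => /predU1P[enu|/(down_neighborP _ pmu) [r [_ ar ->]]].
    by exists 0; rewrite behead_incr0 su.
  exists r.+1; rewrite behead_incrS su; split=> //.
  move: ar; rewrite -su /addable /= nth_behead.
  case: (r) => [_|r'] /=; last by rewrite nth_behead.
  by rewrite -nth_behead su; have := leq_head_sumn nu; lia.
have [w [tw xw e']] := word_delete_inv tu xu ae0.
have := word_delete_spec tw xw; rewrite e' => -[_ sw _].
have := word_step tw xw; rewrite e' /= e /= => -[_ _ _ eww1].
exists w, (x :: i); rewrite /= e' /= e /= good tr sw be0 su szi; split=> //.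
- by split=> // y; rewrite -eww1 ew1.
by split=> // y; rewrite inE => /predU1P[->//|/subi]; rewrite eww1.
Qed.

Lemma word_is_row n w : tableau_word w -> unzip1 w =i iota 1 n ->
  behead (word_shape w) = [::] -> w = row_word n.
Proof.
move=> tw ew bw; have vals := tableau_word_values tw ew.
rewrite /row_word -vals; elim: w bw {tw ew vals} => //= -[v a] w IH /=.
case: a => [|a]; first by rewrite behead_incr0 => /IH {1}->.
rewrite behead_incrS => /(congr1 sumn); by rewrite sumn_incr_nth.
Qed.

Lemma vacillating_row_word m (i : seq nat) : 0 < m -> all (fun x => 0 < x <= m) i ->
  vacillating m i = word_trace (row_word m) i.
Proof.
move=> m0 im; rewrite /vacillating -tab_row_word // vacillating_from_tab ?tableau_row_word //.
by move=> x xi; rewrite mem_row_word mem_iota; have /= := allP im x xi; lia.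
Qed.

(** Once all insertions bump, the traces below the first row do not depend on the
    length of the initial row. *)
Lemma word_trace_stable m m' (i : seq nat) : all (geq m) i -> always_bumps (row_word m) i ->
  m <= m' -> always_bumps (row_word m') i /\
    map behead (word_trace (row_word m') i) = map behead (word_trace (row_word m) i).
Proof.
move=> lei good; elim: m' => [|m' IH] le; first by move: le good; rewrite leqn0 => /eqP ->.
move: le; rewrite leq_eqVlt => /predU1P[<- //|lt].
have [good' e] := IH lt; rewrite row_wordS -e; apply: word_trace_cons0 => //.
by apply: sub_all lei => x /= ?; lia.
Qed.

Lemma limit_bumps n m (i : seq nat) : all (fun x => 0 < x <= n) i -> n + 2 * size i < m ->
  always_bumps (row_word m) i.
Proof.
move=> lei lt; apply: (@enough_zeros_bump n); rewrite ?tableau_row_word //.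
- by move=> x xi; rewrite mem_row_word mem_iota; have /= := allP lei x xi; lia.
- by apply: sub_all lei => x /= /andP[].
by rewrite late_zeros_row_word; lia.
Qed.

(** A limiting tableau is the trace at one large m, hence a path.  For the
    converse, the row of length 2k + 1 that realizes a path is compared with the row
    of any m beyond the limit bound through the longer of the two. *)
Lemma limiting_vacillating_tableauxE k :
  limiting_vacillating_tableaux k = [set` remove_add_paths k [::]]%classic.
Proof.
apply/seteqP; split=> P /=.
  move=> [i [i0 lim]]; pose n := \max_(x <- i) x.
  have iS : size i = k by rewrite size_tuple.
  have ile : all (fun x => 0 < x <= n) i.
    by apply/allP=> x xi; have /= -> := allP i0 x xi; rewrite /n (@leq_bigmax_seq _ _ xpredT).
  pose m := (n + 2 * k).+1; have lt : n + 2 * k < m by [].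
  rewrite -(lim n m ile lt) /simplified vacillating_row_word //; last first.
    by apply: sub_all ile => x /=; rewrite /m; lia.
  have := @word_trace_path (row_word m) i (tableau_row_word m).
  rewrite iS (_ : behead _ = [::]).
    apply; last by apply: (@limit_bumps n); rewrite ?iS.
    by move=> x xi; rewrite mem_row_word mem_iota; have /= := allP ile x xi; rewrite /m; lia.
  by elim: (m) => // m' IH; rewrite row_wordS /= behead_incr0.
move=> Pin; have [//|w [i [[tw ew] sw [szi subi] good tr]]] :=
  @remove_add_path_realized k k [::] P isT _ Pin.
have ew' := word_is_row tw ew sw; subst w; set n := k.*2.+1 in tw ew sw subi good tr.
have lein : all (geq n) i.
  by apply/allP=> x /subi; rewrite mem_row_word mem_iota /=; lia.
exists (Tuple (introT eqP szi)); split=> /=.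
  by apply/allP=> x /subi; rewrite mem_row_word mem_iota => /andP[].
move=> n' m' /= ile lt.
have leim : all (fun x => 0 < x <= m') i by apply: sub_all ile => x /=; lia.
have good' : always_bumps (row_word m') i by apply: (limit_bumps ile); rewrite szi.
have leim' : all (geq m') i by apply: sub_all leim => x /= /andP[].
rewrite /simplified vacillating_row_word //; last by lia.
have [_ <-] := word_trace_stable leim' good' (leq_maxl m' n).
by have [_ ->] := word_trace_stable lein good (leq_maxr m' n).
Qed.
(** * Standard tableaux as words *)
Lemma partial_tableauP T :
  reflect [/\ is_partition (shape T), uniq (flatten T), 0 \notin flatten T,
    (forall r, sorted ltn (nth [::] T r)) &
    (forall r c, is_box T r.+1 c -> entry T r c < entry T r.+1 c)]
  (is_partial_tableau T).
Proof.
apply: (iffP and5P) => -[pT uT zT rows cols]; split=> //.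
- move=> r; case: (ltnP r (size T)) => [lt|ge]; last by rewrite nth_default.
  exact: (all_nthP [::] rows).
- move=> r c b; have := sortedP [::] cols => /(_ r (is_box_size b)).
  by move/allP/(_ c); rewrite mem_iota; apply.
- by apply/(all_nthP [::]) => r _; exact: rows.
apply/(sortedP [::]) => r _; apply/allP=> c; rewrite mem_iota => /= lt.
exact: cols.
Qed.

Lemma entry_below v T r c : below v T -> is_box T r c -> entry T r c < v.
Proof.
move=> bT b; apply: (allP bT); apply/flattenP; exists (nth [::] T r); last exact: mem_nth.
by apply: mem_nth; exact: is_box_size b.
Qed.

Lemma partial_tableau_add_cell T a v : is_partial_tableau T -> 0 < v -> below v T ->
  addable (shape T) a -> is_partial_tableau (add_cell T a v).
Proof.
move=> /partial_tableauP[pT uT zT rows cols] v0 bT ad; apply/partial_tableauP.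
have fl := perm_add_cell T a v.
have vT : v \notin flatten T by apply/negP => /(allP bT) /=; rewrite ltnn.
split.
- by rewrite shape_add_cell; exact: partition_incr.
- by rewrite (perm_uniq fl) /= vT.
- by rewrite (perm_mem fl) inE negb_or zT andbT eq_sym -lt0n.
- move=> r; rewrite nth_add_cell; case: eqP => // _; have := rows a.
  rewrite !(sorted_pairwise ltn_trans) pairwise_rcons => ->; rewrite andbT.
  apply/allP=> x xr; apply: (allP bT); apply/flattenP; exists (nth [::] T a) => //.
  by apply: mem_nth; case: ltnP xr => // ge; rewrite nth_default.
move=> r c; rewrite is_box_add_cell !entry_add_cell.
have le : size (nth [::] T r.+1) <= size (nth [::] T r).
  by rewrite -!nth_shape; exact: partition_leq.
case: ifP => [/andP[/eqP ea /eqP ec]|_].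
  by rewrite -ea (gtn_eqF (ltnSn r)) /= orbF /is_box ec -ea ltnNge le.
case: ifP => [/andP[/eqP ea /eqP ec] _|_]; last by rewrite orbF => /cols.
apply: entry_below bT _; move: ad; rewrite /is_box ec -ea addableS /removable.
by rewrite !nth_shape.
Qed.

Lemma partial_tableau_tab w : tableau_word w -> 0 \notin unzip1 w ->
  is_partial_tableau (tab w).
Proof.
elim: w => // -[v a] w IH /= /and3P[ltv aa tw].
rewrite inE negb_or eq_sym -lt0n => /andP[v0 z].
by apply: partial_tableau_add_cell; rewrite ?IH ?below_tab ?shape_tab.
Qed.

Lemma partition_size_leq la : is_partition la -> size la <= sumn la.
Proof.
case/andP=> _; elim: la => //= n la IH; rewrite inE negb_or eq_sym -lt0n => /andP[n0 /IH].
lia.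
Qed.

Lemma leq_nth_sumn la r : nth 0 la r <= sumn la.
Proof.
elim: la r => [|n la IH] [|r] //=; first by rewrite leq_addr.
by apply: leq_trans (IH r) _; rewrite leq_addl.
Qed.

Lemma exists_max (s : seq nat) : s != [::] ->
  exists2 m, m \in s & {in s, forall x, x <= m}.
Proof.
elim: s => // x s IH _; have [->|/IH [m ms le]] := eqVneq s [::].
  by exists x; rewrite ?mem_head // => y; rewrite mem_seq1 => /eqP ->.
exists (maxn x m) => [|y].
  by rewrite /maxn; case: ifP => _; rewrite inE ?ms ?orbT ?eqxx.
by rewrite inE leq_max => /predU1P[->|/le ->]; rewrite ?leqnn ?orbT.
Qed.

(** The largest entry ends its row and has nothing below it; removing it leaves a
    partial tableau. *)
Lemma tab_of_partial_tableau T : is_partial_tableau T ->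
  exists2 w, tableau_word w & tab w = T.
Proof.
move: {2}(size (flatten T)) (erefl (size (flatten T))) => n.
elim: n T => [|n IH] T e tT; have [pT uT zT rows cols] := partial_tableauP _ tT.
  exists [::] => //=; case: T pT e {tT uT zT rows cols} => // R T /andP[_] /=.
  by rewrite inE negb_or size_cat; case: R.
have [m mT lem] : exists2 m, m \in flatten T & {in flatten T, forall x, x <= m}.
  by apply: exists_max; rewrite -size_eq0 e.
pose r := (position m T).1; pose c := (position m T).2.
have brc : is_box T r c := position_box mT.
have erc : entry T r c = m.
  by rewrite /entry nth_index // -index_mem.
have ltr : r < size T := is_box_size brc.
pose R := nth [::] T r; pose R0 := take c R.
have Rin x : x \in R -> x \in flatten T.
  by move=> xR; apply/flattenP; exists R => //; exact: mem_nth.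
have szR : size R = c.+1.
  apply/eqP; rewrite eqn_leq [c < _]brc andbT leqNgt; apply/negP => lt.
  have := lem _ (Rin _ (mem_nth 0 lt)); rewrite -erc leqNgt => /negP; apply.
  exact: (sortedP 0 (rows r) c lt).
have RE : R = rcons R0 m.
  by rewrite /R0 -erc /entry -/R -take_nth -szR ?take_size // szR.
have short : size (nth [::] T r.+1) <= c.
  rewrite leqNgt; apply/negP => b; have := cols r c b; rewrite erc ltnNge => /negP; apply.
  apply: lem; apply/flattenP; exists (nth [::] T r.+1); last exact: mem_nth.
  by apply: mem_nth; exact: (@is_box_size _ _ c).
(* If the largest entry is alone in its row, that row is the last one, and it
   has to disappear. *)
pose T0 := if c == 0 then take r T else set_nth [::] T r R0.
have nthT0 i : nth [::] T0 i = if i == r then R0 else nth [::] T i.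
  rewrite /T0; have [c0|_] := eqVneq c 0; last by rewrite nth_set_nth.
  have R00 : R0 = [::] by rewrite /R0 c0 take0.
  have lastr k : r < k -> nth [::] T k = [::].
    move=> lt; apply: size0nil; apply/eqP; rewrite -leqn0 -nth_shape.
    have : nth 0 (shape T) r.+1 <= 0 by rewrite nth_shape -c0.
    elim: k lt => // k IHk; rewrite ltnS leq_eqVlt => /predU1P[->//|lt le0].
    by apply: leq_trans (partition_leq k pT) _; exact: IHk.
  case: (ltngtP i r) => [lt|gt|->].
  - by rewrite nth_take.
  - by rewrite nth_default ?size_take ?ltr 1?ltnW // lastr.
  by rewrite nth_default ?size_take ?ltr // R00.
have TE : T = add_cell T0 r m.
  apply: (@eq_from_nth _ [::]) => [|i _].
    rewrite size_add_cell /T0; case: eqP => [c0|_]; last by rewrite size_set_nth; lia.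
    rewrite size_take ltr; have : nth 0 (shape T) r.+1 = 0 by rewrite nth_shape; lia.
    have := partition_gt0 r.+1 pT; rewrite size_map; lia.
  by rewrite nth_add_cell !nthT0 eqxx; case: eqP => // ->; exact: RE.
have fl := perm_add_cell T0 r m; rewrite -TE in fl.
have szR0 : size R0 = c by rewrite /R0 size_take szR ltnSn.
have nthR0 j : j < c -> nth 0 R0 j = entry T r j by move=> lt; rewrite /R0 nth_take.
have pT0 : is_partition (shape T0).
  apply: partitionI => i; rewrite !nth_shape !nthT0.
    have := partition_leq i pT; rewrite !nth_shape => le.
    case: (eqVneq i.+1 r) => [e1|_]; case: (eqVneq i r) => [e2|_]; rewrite ?szR0; try lia.
    - by move: le; rewrite e1 -/R szR; lia.
    by rewrite e2.
  rewrite size_map => lt; case: (eqVneq i r) lt => [->|nir].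
    rewrite szR0 lt0n /T0; case: (c == 0) => //.
    by rewrite size_take ltr ltnn.
  rewrite -nth_shape partition_gt0 // size_map /T0; case: (c == 0).
    by rewrite size_take ltr => lt; exact: ltn_trans lt ltr.
  by rewrite size_set_nth (maxn_idPr ltr).
have tT0 : is_partial_tableau T0.
  apply/partial_tableauP; split=> //.
  - by move: uT; rewrite (perm_uniq fl) /= => /andP[].
  - by move: zT; rewrite (perm_mem fl) inE negb_or => /andP[].
  - move=> i; rewrite nthT0; case: eqP => // _; apply: take_sorted; exact: rows.
  move=> i j; rewrite /is_box /entry !nthT0.
  case: (eqVneq i.+1 r) => [e1|_]; case: (eqVneq i r) => [e2|_].
  - by move: e1; rewrite e2; lia.
  - by rewrite szR0 => lt; rewrite nthR0 // -e1 cols // /is_box e1 -/R szR ltnW.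
  - by move=> lt; rewrite nthR0 ?(leq_trans lt) ?e2 //; apply: cols; rewrite -e2.
  exact: cols.
have ltm : below m T0.
  apply/allP=> x xT0 /=; have : x != m.
    by move: uT; rewrite (perm_uniq fl) /= => /andP[mT0 _]; apply: contraNneq mT0 => <-.
  by rewrite ltn_neqAle => -> /=; apply: lem; rewrite (perm_mem fl) inE xT0 orbT.
have sz0 : size (flatten T0) = n by have := perm_size fl; rewrite e => -[].
have [w tw ew] := IH T0 sz0 tT0.
exists ((m, r) :: w); rewrite /= ?ew -?TE // tw andbT -below_tab ew ltm -shape_tab ew /=.
rewrite /addable; case: eqP => //= /eqP; rewrite -lt0n => r0.
rewrite !nth_shape !nthT0 eqxx szR0 ltn_eqF ?prednK // -szR.
have := partition_leq r.-1 pT; rewrite !nth_shape prednK //; exact.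
Qed.
Fixpoint standard_words (j : nat) : seq word :=
  if j is j'.+1 then
    [seq (j, r) :: w | w <- standard_words j',
       r <- [seq r <- iota 0 (size (word_shape w)).+1 | addable (word_shape w) r]]
  else [:: [::]].

Lemma standard_wordsP j w :
  reflect (tableau_word w /\ unzip1 w = rev (iota 1 j)) (w \in standard_words j).
Proof.
elim: j w => [|j IH] w.
  by rewrite mem_seq1; apply: (iffP eqP) => [-> //|[_]]; case: w.
rewrite iota1S rev_rcons.
apply: (iffP allpairsPdep) => [[w' [r [/IH[tw' ew'] + ->]]]|].
  rewrite mem_filter => /andP[ar _] /=; rewrite tw' ar ew' !andbT; split=> //.
  by apply/allP=> x; rewrite mem_rev mem_iota /=; lia.
case: w => [|[v a] w] [] // /and3P[_ aa tw] [-> ew]; exists w, a; split=> //.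
  exact/IH.
rewrite mem_filter aa mem_iota ltnS; exact: addable_size (word_shape_partition tw) aa.
Qed.

Lemma standard_words_uniq j : uniq (standard_words j).
Proof.
elim: j => // j IH; apply: allpairs_uniq_dep => // [w _|].
  by rewrite filter_uniq ?iota_uniq.
by move=> [w r] [w' r'] _ _ /= [-> ->].
Qed.

(** Standard words of length j are the chains of j additions from the empty
    partition. *)
Lemma sum_standard_words j h :
  \sum_(w <- standard_words j) h (word_shape w) = iter j up_sum h [::].
Proof.
elim: j h => [|j IH] h; first by rewrite big_seq1.
rewrite iterSr -IH big_allpairs_dep; apply: eq_bigr => w _.
by rewrite big_filter /up_sum /index_iota subn0.
Qed.

(** The largest entry shows the row of the first letter. *)
Lemma tab_inj j : {in standard_words j &, injective tab}.
Proof.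
elim: j => [|j IH] w w'; first by rewrite !mem_seq1 => /eqP -> /eqP ->.
move=> /allpairsPdep[w1 [r1 [in1 + ->]]] /allpairsPdep[w2 [r2 [in2 + ->]]].
rewrite !mem_filter => /andP[ad1 _] /andP[ad2 _] /= e.
have new u : u \in standard_words j -> j.+1 \notin flatten (tab u).
  by case/standard_wordsP=> _ eu; rewrite (perm_mem (perm_tab u)) eu mem_rev mem_iota; lia.
have := position_new_cell r1 (new _ in1); rewrite e position_new_cell ?new // => -[er es].
subst r2; congr ((_, _) :: _); apply: IH => //.
have [[tw1 _] [tw2 _]] := (standard_wordsP _ _ in1, standard_wordsP _ _ in2).
by rewrite -(delete_corner_tab j.+1 tw1 ad1) e -es delete_corner_tab.
Qed.

Lemma standard_tableauP j T :
  reflect (is_standard_tableau T /\ sumn (shape T) = j) (T \in map tab (standard_words j)).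
Proof.
apply: (iffP mapP) => [[w /standard_wordsP[tw ew] ->]|[/andP[pT perm] <-]].
  have sz : sumn (shape (tab w)) = j.
    by rewrite shape_tab sumn_word_shape -(size_map fst) -/(unzip1 w) ew size_rev size_iota.
  split=> //; rewrite /is_standard_tableau sz partial_tableau_tab //=.
    by apply: perm_trans (perm_tab w) _; rewrite ew perm_rev.
  by rewrite ew mem_rev mem_iota.
have [w tw ew] := tab_of_partial_tableau pT; exists w => //; apply/standard_wordsP; split=> //.
apply: tableau_word_values => // x.
by rewrite -(perm_mem perm) -ew (perm_mem (perm_tab w)).
Qed.

(** Used twice, to lift rows and then tableaux to the bounded finite types. *)
Lemma bseq_lift (A : finType) (B : eqType) (f : A -> B) n (s : seq B) :
  size s <= n -> {in s, forall y, exists x, f x = y} ->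
  exists s' : {bseq n of A}, map f s' = s.
Proof.
move=> len lift; have [s' es'] : exists s', map f s' = s.
  elim: s lift {len} => [|y s IH] lift; first by exists [::].
  have [x ex] := lift y (mem_head _ _).
  have [|s' es'] := IH; first by move=> z zs; apply: lift; rewrite inE zs orbT.
  by exists (x :: s'); rewrite /= ex es'.
have les' : size s' <= n by rewrite -(size_map f) es'.
by exists (Bseq les').
Qed.

Lemma bounded_seq_lift j (s : seq nat) : size s <= j -> {in s, forall x, x <= j} ->
  exists s' : bounded_seq j, seq_of_bounded s' = s.
Proof.
move=> sz le; apply: bseq_lift => // x /le lex.
by exists (Ordinal (lex : x < j.+1)).
Qed.

Lemma seq_of_bounded_inj j : injective (@seq_of_bounded j).
Proof. by move=> s s' e; apply/val_inj/(inj_map val_inj). Qed.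

Lemma num_standard_tableauxE j la : sumn la = j ->
  num_standard_tableaux la = count (fun w => word_shape w == la) (standard_words j).
Proof.
move=> <-; set n := sumn la; pose rows (T : {bseq n of bounded_seq n}) :=
  [seq seq_of_bounded R | R <- T].
have rows_inj : injective rows.
  by move=> T T' e; apply/val_inj/(inj_map (@seq_of_bounded_inj n)).
rewrite /num_standard_tableaux -/n -size_filter cardE -(size_map rows).
rewrite -(size_map tab [seq w <- _ | _]); apply: perm_size; apply: uniq_perm.
- by rewrite map_inj_uniq ?enum_uniq.
- rewrite map_inj_in_uniq ?filter_uniq ?standard_words_uniq // => w w'.
  rewrite !mem_filter => /andP[_ h] /andP[_ h']; exact: (tab_inj h h').
move=> T; apply/mapP/mapP => [[B]|[w]].
  rewrite mem_enum inE => /andP[stB /eqP shB] ->.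
  have /mapP[w win ew] : rows B \in map tab (standard_words n).
    by apply/standard_tableauP; rewrite shB.
  by exists w => //; rewrite mem_filter win -shape_tab -ew shB eqxx.
rewrite mem_filter => /andP[/eqP shw win] ->.
have [st sz] : is_standard_tableau (tab w) /\ sumn (shape (tab w)) = n.
  by apply/standard_tableauP/map_f.
have pla : is_partition la by case/standard_wordsP: win => /word_shape_partition; rewrite shw.
have [|R Rin|B eB] := @bseq_lift _ _ (@seq_of_bounded n) n (tab w).
- by have := partition_size_leq pla; rewrite -shw -shape_tab size_map sz.
- apply: bounded_seq_lift.
    have := leq_nth_sumn (shape (tab w)) (index R (tab w)).
    by rewrite nth_shape nth_index // sz.
  move=> x xR; have : x \in flatten (tab w) by apply/flattenP; exists R.
  by case/andP: st => _ perm; rewrite (perm_mem perm) sz mem_iota; lia.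
exists B => //; rewrite mem_enum inE -/(rows B) [rows B]eB st /=.
by rewrite shape_tab shw.
Qed.

Lemma sum_num_standard_tableaux j :
  \sum_(la in partitions_of j) num_standard_tableaux (seq_of_bounded la) =
  iter j up_sum (fun=> 1) [::].
Proof.
rewrite -sum_standard_words.
rewrite (eq_bigr (fun la => \sum_(w <- standard_words j)
    (word_shape w == seq_of_bounded la))) => [|la]; last first.
  rewrite inE => /andP[_ /eqP /num_standard_tableauxE ->].
  by rewrite -sum1_count big_mkcond; apply: eq_bigr => w _; case: (_ == _).
rewrite exchange_big; apply: eq_big_seq => w /standard_wordsP[tw ew] /=.
have sz : sumn (word_shape w) = j.
  by rewrite sumn_word_shape -(size_map fst) -/(unzip1 w) ew size_rev size_iota.
have pw := word_shape_partition tw.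
have [||la ela] := @bounded_seq_lift j (word_shape w).
- by rewrite -sz partition_size_leq.
- by move=> x /(nthP 0) [r _ <-]; rewrite -sz leq_nth_sumn.
rewrite (bigD1 la) ?inE ?ela ?pw ?sz ?eqxx //= big1 // => mu /andP[_ ne].
by rewrite -ela (inj_eq (@seq_of_bounded_inj j)) eq_sym (negPf ne).
Qed.

(** * The enumeration *)
Lemma card_eq_uniq_seq (T : choiceType) (s : seq T) :
  uniq s -> ([set` s] #= `I_(size s))%card.
Proof.
elim: s => [_|x s IH /andP[nxs us]].
  by rewrite classical_sets.set_nil II0.
apply/eq_cardSP; exists x; first by rewrite /= mem_head.
rewrite (_ : (_ `\` _)%classic = [set` s]%classic); first exact: IH.
apply/seteqP; split=> y /=; rewrite inE.
  by case=> /orP[/eqP ->|].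
by move=> ys; split; [rewrite ys orbT|move=> e; rewrite -e ys in nxs].
Qed.

Theorem proposition7 (k : nat) (hk : 0 < k) :
  (limiting_vacillating_tableaux k #=
    `I_ (\sum_(1 <= j < k.+1)
          stirling2 k j *
          \sum_(la in partitions_of j)
            num_standard_tableaux (seq_of_bounded la)))%card.
Proof.
rewrite limiting_vacillating_tableauxE.
set N := (X in `I_ X); have <- : size (remove_add_paths k [::]) = N.
  rewrite size_remove_add_paths // step_iterE big_nat_recl // stirling2E.
  case: k hk @N => // k _ N; rewrite mul0n add0n /N big_add1.
  by apply: eq_bigr => j _; rewrite sum_num_standard_tableaux.
have u := @remove_add_paths_uniq k [::] isT.
exact: card_eq_uniq_seq.
Qed.
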